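(* Let $X$ be a shift over a finite alphabet and let $(X_n)_{n\in\mathbb{N}}$ be its SFT cover. Let $\omega\colon\mathbb{N}\to\mathbb{N}$ be the function defined in the context. If there are infinitely many $n\in\mathbb{N}$ such that $X_n=X_{n+\omega(n)}$, then every subshift factor of $X$ has a characteristic measure which is a measure of maximal entropy.
   Context: A shift (subshift) is a non-empty closed $\sigma$-invariant subset $X$ of $\mathcal{A}^{\mathbb{Z}}$, $\mathcal{A}$ a finite alphabet, $(\sigma x)_n=x_{n+1}$. $\mathcal{L}_n(X)$ is the set of words of length $n$ occurring in elements of $X$; $\mathcal{F}(X)$ is the set of finite words over $\mathcal{A}$ occurring in no element of $X$. The SFT cover of $X$ is the sequence $(X_n)$, where $X_n$ is the set of all $x\in\mathcal{A}^{\mathbb{Z}}$ no subword of which is an element of $\mathcal{F}(X)$ of length at most $n$. A subshift factor of $X$ is a shift $Y$ (possibly over another finite alphabet) for which there is a continuous surjection $\pi\colon X\to Y$ with $\pi\circ\sigma=\sigma\circ\pi$. $\mathrm{Aut}(Y)$ is the group of homeomorphisms of $Y$ commuting with $\sigma$. A characteristic measure on $Y$ is a Borel probability measure on $Y$ invariant under every element of $\mathrm{Aut}(Y)$. A measure of maximal entropy is a $\sigma$-invariant Borel probability measure whose entropy equals the topological entropy of $(Y,\sigma)$. For a word $w=w_1\cdots w_{\ell}$, $[w]$ is the cylinder set $\{x\colon x_i=w_i,\ 1\le i\le \ell\}$. For $a,f\in\mathbb{N}$, $\mathcal{X}_{a,f}$ is the set of all subshifts of finite type $X\subseteq\{0,1,\dots,a-1\}^{\mathbb{Z}}$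 that can be defined using only forbidden words of length at most $f$. For $R\in\mathbb{N}$, $\mathcal{Y}_{a,f,R}$ is the set of all sofic shifts $Y\subseteq\{0,1,\dots,a-1\}^{\mathbb{Z}}$ for which there exist $X\in\mathcal{X}_{a,f}$ and a factor map $\varphi\colon X\to Y$ implemented by a block code of range at most $R$ (i.e. $\varphi(x)_t$ is a fixed function of $x_{t-R}\cdots x_{t+R}$). For a shift $Y$, $\mathrm{Per}_{\leq p}(Y)=\bigcup_{q=1}^p\{y\in Y\colon\sigma^qy=y\}$. Fix an infinite set $\mathcal{S}\subseteq\mathbb{N}$ such that for all $a,f,R\in\mathbb{N}$ and all $Y\in\mathcal{Y}_{a,f,R}$ the weak* limit $$\mu_Y:=\lim_{s\in\mathcal{S},\,s\to\infty}\frac{1}{|\mathrm{Per}_{\leq s}(Y)|}\sum_{z\in\mathrm{Per}_{\leq s}(Y)}\delta_z$$ exists and is a characteristic measure of maximal entropy on $Y$ (such a set exists; the sets $\mathrm{Per}_{\le s}(Y)$ are finite, and non-empty for all large $s$). For $a,f,R,k,m\in\mathbb{N}$ let $A(a,f,R,k,m)$ be the least element of $\mathcal{S}$ such that for all $Y\in\mathcal{Y}_{a,f,R}$, all $w\in\bigcup_{i=1}^m\mathcal{L}_i(Y)$, and all $s\in\mathcal{S}$ with $s\geq A(a,f,R,k,m)$, $$\left|\mu_Y([w])-\frac{1}{|\mathrm{Per}_{\leq s}(Y)|}\sum_{z\in\mathrm{Per}_{\leq s}(Y)}\delta_z([w])\right|<\frac1k.$$ For $n\in\mathbb{N}$ let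 $m=m(n)=\inf(\mathcal{S}\setminus\{1,2,\dots,n\})$ and $$\omega(n):=-n+2m+A(m,m,m,m,m)\cdot m^{2m+1}.$$ *)

(* Defs.v *)
From HB Require Import structures.
From mathcomp Require Import all_boot all_order all_algebra finmap.
From mathcomp Require Import all_classical all_reals all_analysis.

Set Implicit Arguments.
Unset Strict Implicit.
Unset Printing Implicit Defensive.
Import Order.TTheory GRing.Theory Num.Theory.
Import numFieldNormedType.Exports.

Local Open Scope classical_set_scope.
Local Open Scope ring_scope.

(* The least element of [P]; 0 if [P] is empty. *)
Definition least (P : set nat) : nat :=
  xget 0%N [set n | P n /\ forall k, P k -> (n <= k)%N].

Definition fullshift (A : finType) : topologicalType :=
  {ptws int -> discrete_topology A}.

Definition shift_map (A : finType) (x : fullshift A) : fullshift A :=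
  fun i => x (i + 1).

(* Invariance is two-sided, [sigma X = X], so that the shift is a homeomorphism
   of [X]. *)
Record subshift (A : finType) := Subshift {
  carrier :> set (fullshift A);
  subshift_nonempty : carrier !=set0;
  subshift_closed : closed carrier;
  subshift_invariant : @shift_map A @` carrier = carrier
}.

(* [points Y] is [Y] as a space of its own, with the induced topology. It is
   pointed, by an arbitrary point, only because measurable types have to be. *)
Section Points.
Variables (A : finType) (Y : subshift A).

Definition points : Type := set_type (carrier Y).

Lemma points_inhabited : exists _ : points, True.
Proof. by have [y Yy] := subshift_nonempty Y; exists (SigSub (mem_set Yy)). Qed.

HB.instance Definition _ := Topological.copy points (set_type (carrier Y)).
HB.instance Definition _ :=
  isPointed.Build points (projT1 (cid points_inhabited)).

Lemma shift_map_in (y : points) : shift_map (val y) \in carrier Y.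
Proof.
rewrite inE -[X in X _](subshift_invariant Y).
by exists (val y) => //; exact: set_valP.
Qed.

Definition sigma (y : points) : points := SigSub (shift_map_in y).

End Points.

Section Words.
Variable A : finType.
Implicit Types (x : fullshift A) (w : seq A) (X : subshift A).

(* The word x_i x_(i+1) ... x_(i+n-1). *)
Definition subword x (i : int) (n : nat) : seq A :=
  mkseq (fun j => x (i + j%:Z)) n.

Definition occurs w x := exists i, subword x i (size w) = w.

Definition language X : set (seq A) :=
  [set w | exists2 x, carrier X x & occurs w x].

Definition forbidden X : set (seq A) := ~` language X.

Definition avoid (F : set (seq A)) : set (fullshift A) :=
  [set x | forall w, F w -> ~ occurs w x].

Definition sft_cover X (n : nat) : set (fullshift A) :=
  avoid [set w | forbidden X w /\ (size w <= n)%N].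

Definition is_sft X := exists F, finite_set F /\ carrier X = avoid F.

Definition cylinder X w : set (points X) :=
  [set x | subword (val x) 1 (size w) = w].

Definition per_le X (p : nat) : set (points X) :=
  [set x | exists2 q, (1 <= q <= p)%N & iter q (@sigma A X) x = x].

End Words.

Arguments cylinder {A} X w.
Arguments per_le {A} X p.

Section Factors.
Variables (A B : finType) (X : subshift A) (Y : subshift B).

Definition factor_map (phi : points X -> points Y) :=
  [/\ continuous phi, set_surj setT setT phi &
      forall x, phi (sigma x) = sigma (phi x)].

Definition subshift_factor := exists phi, factor_map phi.

Definition block_code (r : nat) (phi : points X -> points Y) :=
  exists Phi : seq A -> B, forall x t,
    val (phi x) t = Phi (subword (val x) (t - r%:Z) (2 * r).+1).

End Factors.

Definition is_sofic (B : finType) (Y : subshift B) :=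
  exists (A : finType) (X : subshift A), is_sft X /\ subshift_factor X Y.

(* The alphabet {0, ..., a-1} is ['I_a]. *)
Definition sft_class (a f : nat) (X : subshift 'I_a) :=
  exists F, (forall w, F w -> (size w <= f)%N) /\ carrier X = avoid F.

Definition sofic_class (a f r : nat) (Y : subshift 'I_a) :=
  is_sofic Y /\
  exists (X : subshift 'I_a) (phi : points X -> points Y),
    [/\ sft_class f X, factor_map phi & block_code r phi].

(* The Borel sigma-algebra of [T]. *)
Definition borel (T : ptopologicalType) := g_sigma_algebraType (@open T).

Definition invariant_under (R : realType) (T : ptopologicalType)
    (mu : probability (borel T) R) (g : T -> T) :=
  forall E : set (borel T), measurable E -> mu (g @^-1` E) = mu E.

Section MeasureEntropy.
Variables (R : realType) (T : ptopologicalType).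
Variables (mu : probability (borel T) R) (S : T -> T).

(* A partition into [k] pieces is given by its labelling [P : T -> 'I_k]. The
   sum is the Shannon entropy of the join of the [S^-i P], [i < n], whose pieces
   are named by words [w]; [ln 0 = 0], so empty pieces contribute nothing. *)
Definition join_entropy (k : nat) (P : T -> 'I_k) (n : nat) : R :=
  - \sum_(w : {ffun 'I_n -> 'I_k})
      let p := fine (mu [set x | forall i : 'I_n, P (iter i S x) = w i]) in
      p * ln p.

(* Kolmogorov-Sinai entropy *)
Definition measure_entropy : \bar R :=
  ereal_sup [set h | exists (k : nat) (P : T -> 'I_k),
    (forall i, measurable (P @^-1` [set i] : set (borel T))) /\
    h = (limn (fun n => join_entropy P n / n%:R))%:E].

End MeasureEntropy.

Section TopologicalEntropy.
Variables (R : realType) (T : topologicalType) (S : T -> T).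

Definition open_cover (U : set (set T)) :=
  (forall V, U V -> open V) /\ \bigcup_(V in U) V = setT.

Definition cover_join (U : set (set T)) (n : nat) : set (set T) :=
  [set V | exists u : nat -> set T, (forall i, (i < n)%N -> U (u i)) /\
    V = \bigcap_(i in `I_n) (iter i S @^-1` u i)].

(* The minimal cardinality of a subcover. *)
Definition cover_number (U : set (set T)) : nat :=
  least [set k | exists V : 'I_k -> set T,
    (forall j, U (V j)) /\ \bigcup_j V j = setT].

(* Adler-Konheim-McAndrew entropy, for compact [T] *)
Definition top_entropy : \bar R :=
  ereal_sup [set h | exists U, open_cover U /\
    h = (limn (fun n => ln (cover_number (cover_join U n))%:R / n%:R : R))%:E].

End TopologicalEntropy.

Section Measures.
Variables (R : realType) (A : finType) (Y : subshift A).
Implicit Types (mu : probability (borel (points Y)) R).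

Definition automorphism (g : points Y -> points Y) :=
  (exists h, [/\ continuous g, continuous h, cancel g h & cancel h g]) /\
  forall y, g (sigma y) = sigma (g y).

Definition characteristic mu := forall g, automorphism g -> invariant_under mu g.

Definition max_entropy_measure mu :=
  invariant_under mu (@sigma A Y) /\
  measure_entropy mu (@sigma A Y) = top_entropy R (@sigma A Y).

(* The integral of [f] against the uniform measure on the finite set
   [per_le Y s]; 0 if that set is empty. *)
Definition per_mean (s : nat) (f : points Y -> R) : R :=
  (\sum_(z \in per_le Y s) f z) / #|` fset_set (per_le Y s)|%:R.

Definition per_weak_limit (S : set nat) mu :=
  forall f : points Y -> R, continuous f ->
    per_mean s f @[s --> within S \oo] --> \int[mu]_y f y.

End Measures.

Section Omega.
Variables (R : realType) (S : set nat).
Variable mu : forall (a : nat) (Y : subshift 'I_a),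
  probability (borel (points Y)) R.

(* A(a, f, R, k, m) *)
Definition approx_time (a f r k m : nat) : nat :=
  least [set s0 | S s0 /\
    forall Y : subshift 'I_a, sofic_class f r Y ->
    forall w, language Y w -> (1 <= size w <= m)%N ->
    forall s, S s -> (s0 <= s)%N ->
      `| fine (mu Y (cylinder Y w)) - per_mean s \1_(cylinder Y w) |
        < k%:R^-1].

Definition next_time (n : nat) : nat := least [set s | S s /\ ~~ (1 <= s <= n)%N].

(* [n < next_time n] when [S] is an infinite set of positive numbers, so the
   truncated subtraction is exact. *)
Definition omega (n : nat) : nat :=
  let m := next_time n in
  (2 * m + approx_time m m m m m * m ^ (2 * m).+1 - n)%N.

End Omega.

(* Main.v *)
Require Import Defs.
From HB Require Import structures.
From mathcomp Require Import all_boot all_order all_algebra.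
From mathcomp Require Import all_classical all_reals all_analysis.
From mathcomp Require Import zify lra ring.

(** Write X_n for the n-th SFT cover of X. The factor map X -> Y is a block code
    of some radius r, and this code also maps X_n onto a sofic shift Z_n that
    contains Y. Up to recoding letters, Z_n belongs to the class that the
    parameter m = m(n) > n controls as soon as n is large, so it carries the
    measure of maximal entropy mu_n given by the hypothesis, and mu_n is within
    1/m, on cylinders of length at most m, of the uniform measure kappa_n on the
    points of Z_n of period at most a, where a = A(m, m, m, m, m). The measure
    on Y is a limit of the mu_n along an ultrafilter of indices n with
    X_n = X_(n + omega n).

    Invariance. Let g be an automorphism of Y; it is a block code, and this code
    acts on the full shift but need not preserve Z_n. It does permute the points
    of Z_n of period at most a. Indeed X_n = X_(n + omega n) means that words of
    X_n of length up to n + omega n = 2m + a m^(2m+1) are words of X, hence words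
    of Z_n of almost that length are words of Y, and so are those of the image of
    z under the code of g. If z has period p at most a, lift a long word of this
    image to X. Among its windows of length m at distance multiples of p, two
    coincide by the pigeonhole principle, and repeating the stretch between them
    gives a point of X_n above the image of z ([periodic_lift],
    [automorphism_periodic]). So kappa_n is invariant under the code of g, mu_n
    is almost invariant ([stage_exists]), and the limit is invariant.

    Entropy. The topological entropy of a subshift is the growth rate h of its
    language ([top_entropy_lang]), so that of Z_n is at least h(Y). The entropy
    of an invariant measure is at most H_N / N for every N, where H_N is the
    entropy of the first N symbols ([Hlaw_generator],
    [measure_entropy_le]). Applied to mu_n this gives H_N(mu_n) >= N h(Y), an
    inequality about finitely many cylinders, which therefore passes to the
    limit; as H_N is at most the logarithm of the number of words of length N,
    the limit measure has entropy exactly h(Y).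

    The limit itself is first a finitely additive function of the sets of points
    of Y that are seen through a finite window. By compactness such a function is
    a premeasure and extends to the Borel sets ([extend_windowed]). *)

Set Implicit Arguments.
Unset Strict Implicit.
Unset Printing Implicit Defensive.
Import Order.TTheory GRing.Theory Num.Theory.
Import numFieldNormedType.Exports.

Local Open Scope classical_set_scope.
Local Open Scope ring_scope.

(** * The topology of a shift space *)

Section Agree.
Variable A : finType.
Implicit Types x y z : fullshift A.

Definition agree (k : nat) x y := forall i : int, (`|i| <= k)%N -> x i = y i.

Lemma agree_refl k x : agree k x x. Proof. by []. Qed.
Lemma agree_sym k x y : agree k x y -> agree k y x.
Proof. by move=> h i /h. Qed.
Lemma agree_trans k x y z : agree k x y -> agree k y z -> agree k x z.
Proof. by move=> h g i ik; rewrite h// g. Qed.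
Lemma agree_le k l x y : (k <= l)%N -> agree l x y -> agree k x y.
Proof. by move=> kl h i ik; apply: h; apply: leq_trans kl. Qed.

Lemma nbhs_coord x (i : int) : nbhs x [set y | x i = y i].
Proof.
have /cvg_sup/(_ i) : (nbhs x : set_system (fullshift A)) --> x by exact: cvg_id.
apply=> /=; exists ((fun f : fullshift A => f i) @^-1` [set x i]).
  split=> //; exists [set x i] => //.
by move=> y /= ->.
Qed.

Lemma agree_cvg x (F : set_system (fullshift A)) : Filter F ->
  (forall k, F (agree k x)) -> F --> x.
Proof.
move=> FF h; apply/cvg_sup => i U /=.
case=> V [[W oW <-] /= xi VU].
by apply: filterS (h `|i|%N) => y /(_ i (leqnn _)) /= e; apply: VU; rewrite /= -e.
Qed.

(** Agreement on growing windows is a neighbourhood base. All further topology goes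
    through this lemma and its analogue [points_nbhs] on a subshift. *)
Lemma nbhs_agree x (V : set (fullshift A)) :
  nbhs x V <-> exists k, agree k x `<=` V.
Proof.
split.
- pose F := [set V : set (fullshift A) | exists k, agree k x `<=` V].
  have FF : Filter F.
    split; first by exists 0%N.
    - move=> P Q [k kP] [l lQ]; exists (maxn k l) => y xy; split.
      + by apply: kP; apply: agree_le xy; apply: leq_maxl.
      + by apply: lQ; apply: agree_le xy; apply: leq_maxr.
    - by move=> P Q PQ [k kP]; exists k; apply: subset_trans PQ.
  by move=> xV; apply: (@agree_cvg x F FF _ V xV) => k; exists k.
- move=> [k kV]; apply: filterS kV _.
  have : \forall y \near x, forall j : 'I_(2 * k).+1,
      x (j%:Z - k%:Z) = y (j%:Z - k%:Z).
    by apply: (@filter_forall _ _ _ (nbhs x)) => j; exact: nbhs_coord.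
  apply: filterS => y h i ik.
  have ik2 : (`|(i + k%:Z)%R|%N < (2 * k).+1)%N by lia.
  have /= := h (Ordinal ik2).
  by have -> : `|(i + k%:Z)%R|%N%:Z - k%:Z = i by lia.
Qed.
End Agree.

Lemma ultra_fmap (T U : Type) (f : T -> U) (F : set_system T) :
  UltraFilter F -> UltraFilter (f @ F).
Proof.
move=> FU; split=> [|G GP FG].
  by apply: fmap_proper_filter; exact: ultra_proper.
apply/seteqP; split => // P GPP.
have [//|FnP] := in_ultra_setVsetC (f @^-1` P) FU.
have GnP : G (~` P) by apply: FG.
by have [x []] := filter_ex (filterI GPP GnP).
Qed.

Lemma fullshift_compact (A : finType) : compact [set: fullshift A].
Proof.
have := @tychonoff int (fun=> discrete_topology A) (fun=> setT)
  (fun=> finite_compact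
     (@finite_finset A setT : finite_set (setT : set (discrete_topology A)))).
by congr (@compact _ _); apply/seteqP; split.
Qed.

Lemma closed_agree (A : finType) (C : set (fullshift A)) :
  closed C <-> forall x, (forall k, exists2 y, C y & agree k x y) -> C x.
Proof.
split.
- move=> clC x h; apply: clC => V /nbhs_agree[k kV].
  by have [y Cy xy] := h k; exists y; split => //; apply: kV.
- move=> h x clx; apply: h => k.
  have [|y [Cy xy]] := clx (agree k x); last by exists y.
  by apply/nbhs_agree; exists k.
Qed.

Section Points.
Variables (A : finType) (X : subshift A).

Lemma val_points_inj : injective (val : points X -> fullshift A).
Proof. exact: val_inj. Qed.

Lemma pointsP (x : points X) : carrier X (val x).
Proof. exact: set_valP. Qed.

Definition mkpoint (x : fullshift A) (h : carrier X x) : points X :=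
  SigSub (mem_set h).

Lemma points_nbhs (x : points X) (V : set (points X)) :
  nbhs x V <-> exists k, [set y : points X | agree k (val x) (val y)] `<=` V.
Proof.
split.
- case=> U [[W oW <-] /= xW WV].
  have /nbhs_agree[k kW] : nbhs (val x : fullshift A) W by apply: open_nbhs_nbhs.
  by exists k => y /kW yW; apply: WV.
- move=> [k kV]; apply: filterS kV _.
  have /(_ (agree k (val x))) := @initial_continuous _ _ (val : points X -> fullshift A) x.
  by apply; apply/nbhs_agree; exists k.
Qed.

Lemma points_open (U : set (points X)) :
  open U <-> forall x, U x ->
    exists k, [set y : points X | agree k (val x) (val y)] `<=` U.
Proof.
rewrite openE; split => h x /h; first by move/points_nbhs.
by move=> ?; apply/points_nbhs.
Qed.

Lemma points_compact : compact [set: points X].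
Proof.
rewrite compact_ultra => F FU _.
have : compact (carrier X).
  apply: (@subclosed_compact _ _ setT) => //.
    exact: subshift_closed.
  exact: fullshift_compact.
rewrite compact_ultra => /(_ ((val : points X -> fullshift A) @ F)).
case; first exact: ultra_fmap.
  by apply: (@filterS _ F _ setT); [move=> x _; exact: pointsP|exact: filterT].
move=> x [Xx Fx]; exists (mkpoint Xx); split => // V /points_nbhs[k kV].
apply: filterS kV _; apply: Fx.
by apply/nbhs_agree; exists k.
Qed.

(** Compactness makes uniform the radius of the window through which a point is
    known to lie in a member of the cover. *)
Lemma lebesgue_number (U : set (set (points X))) : open_cover U ->
  exists k, forall x : points X,
    exists2 V, U V & [set y : points X | agree k (val x) (val y)] `<=` V.
Proof.
move=> [oU cU].
pose P (k : nat) (x : points X) :=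
  exists2 V, U V & [set y : points X | agree k (val x) (val y)] `<=` V.
have [|k _ /(_ k (leqnn _)) h] :=
  (compact_near_coveringP [set: points X]).1 points_compact nat \oo P _.
- move=> x _; have : (\bigcup_(V in U) V) x by rewrite cU.
  case=> V UV Vx; have /points_open/(_ _ Vx)[k kV] := oU V UV.
  exists ([set y : points X | agree k (val x) (val y)], [set l | (k <= l)%N]).
    split; first by apply/points_nbhs; exists k.
    by exists k.
  case=> y l /= [xy kl]; exists V => // z yz; apply: kV => /=.
  by apply: agree_trans xy _; apply: agree_le yz.
- by exists k => x; exact: h.
Qed.
End Points.

(** * Words and block codes *)

Section Shift.
Variable A : finType.
Implicit Types x y : fullshift A.

Definition shiftz (t : int) x : fullshift A := fun i => x (i + t).

Lemma shiftz0 x : shiftz 0 x = x.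
Proof. by apply/funext => i; rewrite /shiftz addr0. Qed.

Lemma shiftzD s t x : shiftz s (shiftz t x) = shiftz (s + t) x.
Proof. by apply/funext => i; rewrite /shiftz addrA. Qed.

Lemma shift_map_iter n x : iter n (@shift_map A) x = shiftz n%:Z x.
Proof.
elim: n => [|n IH] /=; first by rewrite shiftz0.
by rewrite IH; apply/funext => i; rewrite /shift_map /shiftz; congr x; lia.
Qed.

Lemma subword_eqP x y i j n :
  subword x i n = subword y j n <->
  forall k, (k < n)%N -> x (i + k%:Z) = y (j + k%:Z).
Proof.
split=> [e k kn|h]; last by apply/eq_in_map => k; rewrite mem_iota => /h.
by have := congr1 (fun s => nth (x i) s k) e; rewrite !nth_mkseq.
Qed.

Lemma size_subword x i n : size (subword x i n) = n.
Proof. exact: size_mkseq. Qed.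

Lemma subword_shift t x i n : subword (shiftz t x) i n = subword x (i + t) n.
Proof. by apply/subword_eqP => k _; rewrite /shiftz addrAC. Qed.

Lemma agree_subword k x y :
  agree k x y <-> subword x (- k%:Z) (2 * k).+1 = subword y (- k%:Z) (2 * k).+1.
Proof.
rewrite subword_eqP; split=> [h j jk|h i ik]; first by apply: h; lia.
have := h `|(i + k%:Z)%R|%N.
have -> : - k%:Z + `|(i + k%:Z)%R|%N%:Z = i by lia.
apply; lia.
Qed.

Lemma occurs_subword x i n : occurs (subword x i n) x.
Proof. by exists i; rewrite size_subword. Qed.

Lemma occurs_shift t w x : occurs w (shiftz t x) <-> occurs w x.
Proof.
split=> -[i <-]; first by rewrite subword_shift; apply: occurs_subword.
exists (i - t); rewrite size_subword subword_shift; congr subword; lia.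
Qed.

Lemma subshift_shift (X : subshift A) t x : carrier X x -> carrier X (shiftz t x).
Proof.
have invD y : carrier X y -> carrier X (shift_map y).
  by move=> Xy; rewrite -(subshift_invariant X); exists y.
have invI y : carrier X y -> carrier X (shiftz (- 1) y).
  move=> Xy; move: (Xy); rewrite -{1}(subshift_invariant X) => -[z Xz <-].
  have -> : shiftz (- 1) (shift_map z) = z; last by [].
  by apply/funext => i; rewrite /shiftz /shift_map; congr z; lia.
case: t => n Xx.
- rewrite -shift_map_iter; elim: n => //= n IH; exact: invD.
- elim: n => [|n IH]; first exact: invI.
  have -> : shiftz (Negz n.+1) x = shiftz (- 1) (shiftz (Negz n) x); last exact: invI.
  by rewrite shiftzD; congr shiftz; lia.
Qed.

(** Invariance allows a word of X to be read at any prescribed position. *)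
Lemma languageE (X : subshift A) w : language X w <->
  forall i, exists2 x : fullshift A, carrier X x & subword x i (size w) = w.
Proof.
split=> [[x Xx [j e]] i|/(_ 0)[x Xx e]]; last by exists x => //; exists 0.
exists (shiftz (j - i) x); first exact: subshift_shift.
by rewrite subword_shift -[RHS]e; congr subword; lia.
Qed.

End Shift.

Section PointShift.
Variables (A : finType) (X : subshift A).

Definition pshift (t : int) (x : points X) : points X :=
  mkpoint (subshift_shift t (pointsP x)).

Lemma sigma_iter n x : iter n (@sigma A X) x = pshift n%:Z x.
Proof.
apply: val_points_inj; rewrite /= -shift_map_iter.
by elim: n => //= n ->.
Qed.

Lemma val_sigma_iter n (x : points X) :
  val (iter n (@sigma A X) x) = shiftz n%:Z (val x).
Proof. by rewrite sigma_iter. Qed.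

Lemma pshiftD s t x : pshift s (pshift t x) = pshift (s + t) x.
Proof. by apply: val_points_inj; rewrite /= shiftzD. Qed.

Lemma pshift0 x : pshift 0 x = x.
Proof. by apply: val_points_inj; rewrite /= shiftz0. Qed.
End PointShift.

Lemma equivariant_pshift (A B : finType) (X : subshift A) (Y : subshift B)
    (f : points X -> points Y) :
  (forall x, f (sigma x) = sigma (f x)) ->
  forall t x, f (pshift t x) = pshift t (f x).
Proof.
move=> fs; have fn n x : f (pshift n%:Z x) = pshift n%:Z (f x).
  by rewrite -!sigma_iter; elim: n => //= n <-.
case=> n x; first exact: fn.
have xE : pshift n.+1%:Z (pshift (Negz n) x) = x.
  rewrite pshiftD; have -> : n.+1%:Z + Negz n = 0 by lia.
  exact: pshift0.
rewrite -[in RHS]xE fn pshiftD; have -> : Negz n + n.+1 = 0 by lia.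
by rewrite pshift0.
Qed.

Section BlockMap.
Variables (A B : finType).
Implicit Types (x : fullshift A) (Phi : seq A -> B).

Definition block_map r Phi x : fullshift B :=
  fun t => Phi (subword x (t - r%:Z) (2 * r).+1).

Lemma block_map_shift r Phi t x :
  block_map r Phi (shiftz t x) = shiftz t (block_map r Phi x).
Proof.
apply/funext => i; rewrite /block_map /= /shiftz subword_shift.
by congr (Phi (subword x _ _)); lia.
Qed.

Lemma block_map_local r Phi x y i j n :
  subword x (i - r%:Z) (n + 2 * r) = subword y (j - r%:Z) (n + 2 * r) ->
  subword (block_map r Phi x) i n = subword (block_map r Phi y) j n.
Proof.
move=> /subword_eqP e; apply/subword_eqP => k kn; congr Phi.
apply/subword_eqP => l lr; have := e (k + l)%N.
have -> : i - r%:Z + (k + l)%N = i + k - r%:Z + l by lia.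
have -> : j - r%:Z + (k + l)%N = j + k - r%:Z + l by lia.
apply; lia.
Qed.

(** The symbol of f x at 0 is a continuous function with finitely many values, so by
    compactness it depends on a fixed window, and equivariance transports this to
    all positions. All large radii are offered so that finitely many maps can be
    given a common one. *)
Lemma curtis_hedlund_lyndon (X : subshift A) (Y : subshift B)
    (f : points X -> points Y) : continuous f ->
  (forall x : points X, f (sigma x) = sigma (f x)) ->
  exists r0, forall r, (r0 <= r)%N ->
    exists Phi, forall x : points X, val (f x) = block_map r Phi (val x).
Proof.
move=> cf /equivariant_pshift fs.
pose cell b := f @^-1` [set y : points Y | val y 0 = b].
have [|k kP] := @lebesgue_number _ X (range cell).
  split=> [_ [b _ <-]|].
    move/continuousP: cf; apply; apply/points_open => y <-; exists 0%N => z.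
    by move=> yz; exact/esym/yz.
  by apply/seteqP; split=> // x _; exists (cell (val (f x) 0)).
exists k => r kr.
pose x0 : points X := point.
pose window (x : points X) := subword (val x) (- r%:Z) (2 * r).+1.
(* Windows that do not occur in X are given an arbitrary letter. *)
pose Phi w := if pselect (exists x : points X, window x = w) is left h
  then val (f (projT1 (cid h))) 0 else val (f x0) 0.
exists Phi => x; apply/funext => t.
have -> : val (f x) t = val (f (pshift t x)) 0 by rewrite fs /= /shiftz add0r.
rewrite /block_map /Phi; case: pselect => [h|[]]; last first.
  by exists (pshift t x); rewrite /window /= subword_shift; congr subword; lia.
case: cid => y /=; rewrite /window => yx.
have [_ [b _ <-] bP] := kP y.
rewrite (bP y _) //; apply: bP => /=; apply: agree_le kr _; apply/agree_subword.
by rewrite yx subword_shift; congr subword; lia.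
Qed.
End BlockMap.

(** * Shannon entropy of finite distributions *)

Section Entropy.
Variable R : realType.
Implicit Types V W : finType.

Definition entropy V (p : V -> R) : R := - \sum_v p v * ln (p v).

Definition image_law V W (f : V -> W) (p : V -> R) (w : W) : R :=
  \sum_(v | f v == w) p v.

Lemma ln_le_subr1 (x : R) : 0 < x -> ln x <= x - 1.
Proof.
move=> x0; rewrite -[in ln _](subrK 1 x) addrC; apply: le_ln1Dx.
by rewrite ltrBrDl subrr.
Qed.

(** Termwise from ln x <= x - 1, applied to q / p. Subadditivity of entropy and its bound
    by the number of values are this inequality for suitable q. *)
Lemma gibbs V (p q : V -> R) : (forall v, 0 <= p v) -> (forall v, 0 <= q v) ->
  (forall v, q v = 0 -> p v = 0) -> \sum_v q v <= \sum_v p v ->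
  entropy p <= - \sum_v p v * ln (q v).
Proof.
move=> p0 q0 qp qp1; rewrite /entropy lerN2.
apply: (@le_trans _ _ (\sum_v (p v * ln (p v) + (q v - p v)))); last first.
  by rewrite big_split/= sumrB gerDl subr_le0.
apply: ler_sum => v _.
have [pv0|pv0] := eqVneq (p v) 0; first by rewrite pv0 !mul0r add0r subr0.
have pv : 0 < p v by rewrite lt_neqAle eq_sym pv0 p0.
have qv : 0 < q v.
  by rewrite lt_neqAle q0 andbT eq_sym; apply: contra_neq pv0 => /qp.
have := ln_le_subr1 (divr_gt0 qv pv); rewrite ln_div ?posrE// => h.
rewrite addrC -lerBlDr -mulrBr (le_trans (ler_wpM2l (p0 v) h))//.
by rewrite mulrBr mulr1 mulrC divfK.
Qed.

Lemma image_law_ge0 V W (f : V -> W) (p : V -> R) w :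
  (forall v, 0 <= p v) -> 0 <= image_law f p w.
Proof. by move=> p0; apply: sumr_ge0. Qed.

Lemma le_image_law V W (f : V -> W) (p : V -> R) v :
  (forall v, 0 <= p v) -> p v <= image_law f p (f v).
Proof. by move=> p0; rewrite /image_law (bigD1 v)//= lerDl sumr_ge0. Qed.

Lemma sum_image_law V W (f : V -> W) (p : V -> R) (g : W -> R) :
  \sum_w image_law f p w * g w = \sum_v p v * g (f v).
Proof.
rewrite [RHS](partition_big f xpredT)//=; apply: eq_bigr => w _.
by rewrite /image_law mulr_suml; apply: eq_bigr => v /eqP ->.
Qed.

Lemma sum_image_law1 V W (f : V -> W) (p : V -> R) :
  \sum_w image_law f p w = \sum_v p v.
Proof.
have := sum_image_law f p (fun=> 1).
by under eq_bigr do rewrite mulr1; under [in RHS]eq_bigr do rewrite mulr1.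
Qed.

(** The mass of a fibre of f dominates the mass of each of its points, and the
    logarithm is increasing. *)
Lemma entropy_push V W (f : V -> W) (p : V -> R) : (forall v, 0 <= p v) ->
  entropy (image_law f p) <= entropy p.
Proof.
move=> p0; rewrite /entropy (sum_image_law f p (fun w => ln (image_law f p w))) lerN2.
apply: ler_sum => v _.
have [->|pv0] := eqVneq (p v) 0; first by rewrite !mul0r.
have pv : 0 < p v by rewrite lt_neqAle eq_sym pv0 p0.
rewrite ler_wpM2l// ler_ln ?posrE//; first exact: le_image_law.
exact: lt_le_trans pv (le_image_law _ _ _).
Qed.

(** Gibbs against the product of the marginals. *)
Lemma entropy_pair V W (p : V * W -> R) : (forall v, 0 <= p v) ->
  \sum_v p v = 1 ->
  entropy p <= entropy (image_law fst p) + entropy (image_law snd p).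
Proof.
move=> p0 p1; pose a := image_law fst p; pose b := image_law snd p.
apply: (le_trans (@gibbs _ p (fun v => a v.1 * b v.2) p0 _ _ _)).
- by move=> v; rewrite mulr_ge0// image_law_ge0.
- move=> v /eqP; rewrite mulf_eq0 => /orP[] /eqP e; apply/eqP;
    rewrite eq_le p0 andbT -e; exact: le_image_law.
- rewrite -(pair_bigA _ (fun v w => a v * b w))/=.
  under eq_bigr do rewrite -mulr_sumr sum_image_law1 p1 mulr1.
  by rewrite sum_image_law1.
- rewrite /entropy (sum_image_law fst p (fun v => ln (a v))).
  rewrite (sum_image_law snd p (fun v => ln (b v))) -opprD -big_split/=.
  rewrite lerN2; apply: ler_sum => v _; rewrite -mulrDr.
  have [->|pv0] := eqVneq (p v) 0; first by rewrite !mul0r.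
  have pv : 0 < p v by rewrite lt_neqAle eq_sym pv0 p0.
  rewrite lnM// posrE; apply: (lt_le_trans pv); exact: le_image_law.
Qed.

(** Gibbs against the uniform distribution on D. *)
Lemma entropy_card V (p : V -> R) (D : {set V}) : (forall v, 0 <= p v) ->
  \sum_v p v = 1 -> (forall v, v \notin D -> p v = 0) ->
  entropy p <= ln #|D|%:R.
Proof.
move=> p0 p1 pD.
have D0 : (0 < #|D|)%N.
  rewrite lt0n; apply/negP => /eqP/eqP; rewrite cards_eq0 => /eqP D0.
  move: p1; rewrite big1 => [/eqP|v _]; first by rewrite eq_sym oner_eq0.
  by rewrite pD// D0 inE.
have D0' : 0 < #|D|%:R :> R by rewrite ltr0n.
pose q v : R := if v \in D then #|D|%:R^-1 else 0.
apply: (le_trans (@gibbs _ p q p0 _ _ _)).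
- by move=> v; rewrite /q; case: ifP => // _; rewrite invr_ge0 ltW.
- move=> v; rewrite /q; case: ifPn => [_ /eqP|/pD//].
  by rewrite invr_eq0 gt_eqF.
- rewrite p1 /q -big_mkcond/= sumr_const -[X in X <= _]mulr_natr mulVf//.
  by rewrite gt_eqF.
- rewrite -sumrN (eq_bigr (fun v => p v * ln #|D|%:R)) => [|v _].
    by rewrite -mulr_suml p1 mul1r.
  rewrite /q; case: ifPn => [_|/pD ->]; last by rewrite !mul0r oppr0.
  by rewrite lnV ?posrE// mulrN opprK.
Qed.

Lemma entropy_ge0 V (p : V -> R) : (forall v, 0 <= p v <= 1) -> 0 <= entropy p.
Proof.
move=> p01; rewrite oppr_ge0 sumr_le0// => v _.
by rewrite mulr_ge0_le0 ?ln_le0//; case/andP: (p01 v).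
Qed.

(** ln x <= x - 1 at 1 / sqrt x. This controls x ln x near 0, where the logarithm
    itself is unbounded. *)
Lemma xlnx_sqrt (x : R) : 0 <= x <= 1 -> - (x * ln x) <= 2 * Num.sqrt x.
Proof.
case/andP; rewrite le_eqVlt => /predU1P[<-|x0] x1.
  by rewrite mul0r oppr0 sqrtr0 mulr0.
have s0 : 0 < Num.sqrt x by rewrite sqrtr_gt0.
rewrite -[x in x * _](sqr_sqrtr (ltW x0)) -[x in ln x](sqr_sqrtr (ltW x0)).
set s := Num.sqrt x in s0 *.
have := ln_le_subr1 (x := s^-1); rewrite invr_gt0 => /(_ s0).
rewrite lnV ?posrE// => h; rewrite lnXn// -mulrN.
have -> : - (ln s *+ 2) = 2 * - ln s by rewrite mulr_natl mulNrn.
rewrite mulrCA ler_wpM2l//; apply: le_trans (_ : s ^+ 2 * s^-1 <= _).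
  by rewrite ler_wpM2l ?sqr_ge0// (le_trans h)// gerBl.
by rewrite expr2 mulfK// gt_eqF.
Qed.

Lemma continuous_xlnx (x : R) : y * ln y @[y --> x] --> x * ln x.
Proof.
have [x0|x0|->] := ltgtP x 0.
- have h : \forall y \near x, (0 : R) = y * ln y.
    near=> y; have y0 : y < 0 by near: y; exact: lt_nbhsl.
    by rewrite ln0 ?mulr0// ltW.
  rewrite [in X in _ --> X]ln0 ?ltW// mulr0; apply: (cvg_trans (G := (fun=> (0:R)) @ x)).
    exact: near_eq_cvg.
  exact: (@cvg_cst _ _ _ (nbhs x)).
- exact: (@continuousM R _ id (@ln R) x (@cvg_id _ _) (continuous_ln x0)).
- rewrite mul0r; apply/cvgr0Pnorm_lt => e e0.
  have sc : Num.sqrt y @[y --> (0:R)] --> (0:R).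
    by rewrite -[X in _ --> X]sqrtr0; exact: sqrt_continuous.
  have e2 : 0 < e / 2 by rewrite divr_gt0.
  have {}sc := (cvgr0Pnorm_lt _).1 sc _ e2.
  near=> y.
  have [y0|y0] := leP y 0; first by rewrite ln0// mulr0 normr0.
  have y1 : y <= 1 by apply/ltW; near: y; exact/lt_nbhsl/ltr01.
  have yl : y * ln y <= 0 by rewrite mulr_ge0_le0 ?ln_le0 ?(ltW y0).
  rewrite ler0_norm//; apply: le_lt_trans (xlnx_sqrt _) _; first by rewrite (ltW y0).
  have : `|Num.sqrt y| < e / 2 by near: y; exact: sc.
  by rewrite ger0_norm ?sqrtr_ge0// ltr_pdivlMr// mulrC.
Unshelve. all: by end_near. Qed.

Lemma entropy_cvg V (I : Type) (F : set_system I) (p : I -> V -> R) (q : V -> R) :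
  Filter F -> (forall v, p i v @[i --> F] --> q v) ->
  entropy (p i) @[i --> F] --> entropy q.
Proof.
move=> FF h; apply: cvgN.
have := @cvg_big R V +%R 0 xpredT (@add_continuous R^o) I F (index_enum V)
  (fun v i => p i v * ln (p i v)) (fun v => q v * ln (q v)) FF.
apply=> v _.
exact: cvg_comp (h v) (@continuous_xlnx (q v)).
Qed.

(** All masses but one are small, and xlnx_sqrt applies to them; the remaining one
    contributes at most 1 - p v0. The label that records the error between two
    close partitions is of this kind. *)
Lemma entropy_small V (e : R) : 0 < e -> exists2 d : R, 0 < d &
  forall (p : V -> R) v0, (forall v, 0 <= p v) -> \sum_v p v = 1 ->
    1 - p v0 <= d -> entropy p <= e.
Proof.
move=> e0; pose n : R := #|V|%:R + 1.
have n0 : 0 < n by rewrite ltr_wpDl.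
pose t := e / (3 * n).
have t0 : 0 < t by rewrite divr_gt0// mulr_gt0.
(* The bound is in terms of square roots of masses, whence the square. *)
exists (Num.min 1 t ^+ 2); first by rewrite exprn_gt0// lt_min ltr01.
set s := Num.min 1 t => p v0 p0 p1 pv0.
have s0 : 0 < s by rewrite lt_min ltr01.
have s1 : s <= 1 by rewrite ge_min lexx.
have st : s <= t by rewrite ge_min lexx orbT.
have rest : 1 - p v0 = \sum_(v | v != v0) p v.
  by apply/eqP; rewrite subr_eq -p1 (bigD1 v0)//= addrC.
have ple1 v : p v <= 1.
  by rewrite -p1 (bigD1 v)//= lerDl sumr_ge0.
rewrite /entropy -sumrN; apply: (@le_trans _ _ (\sum_(v : V) 3 * s)).
  apply: ler_sum => v _; have [->|vv0] := eqVneq v v0.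
    have [pv|pv] := eqVneq (p v0) 0; first by rewrite pv mul0r oppr0 mulr_ge0// ltW.
    have {}pv : 0 < p v0 by rewrite lt_neqAle eq_sym pv p0.
    have := ln_le_subr1 (x := (p v0)^-1); rewrite invr_gt0 => /(_ pv).
    rewrite lnV ?posrE// => h; rewrite -mulrN.
    apply: (le_trans (ler_wpM2l (p0 _) h)).
    rewrite mulrBr mulfV ?gt_eqF// mulr1; apply: (le_trans pv0).
    rewrite expr2 ler_pM2r// (le_trans s1)// ler1n//.
  apply: (le_trans (xlnx_sqrt _)); first by rewrite p0 ple1.
  apply: ler_pM; rewrite ?sqrtr_ge0 ?ler_nat//.
  rewrite -[leRHS](ger0_norm (ltW s0)) -sqrtr_sqr ler_wsqrtr//.
  by apply: le_trans pv0; rewrite rest (bigD1 v)//= lerDl sumr_ge0.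
rewrite sumr_const -[leLHS]mulr_natr.
apply: (@le_trans _ _ (3 * t * n)); last first.
  rewrite /t mulrAC mulrC divfK//.
  by rewrite gt_eqF// mulr_gt0.
rewrite ler_pM//; first by rewrite mulr_ge0// ltW.
  by rewrite ler_pM2l.
by rewrite lerDl.
Qed.
End Entropy.

(** * Entropy of itineraries and generators *)

Section Labels.
Context (d : measure_display) (T : measurableType d) (R : realType).
Variable mu : probability T R.
Implicit Types V W : finType.

Definition mlabel V (F : T -> V) := forall v, measurable (F @^-1` [set v]).

Definition law V (F : T -> V) (v : V) : R := fine (mu (F @^-1` [set v])).

Definition Hlaw V (F : T -> V) : R := entropy (law F).

Lemma preimage_bigcup1 V (F : T -> V) (D : set V) :
  F @^-1` D = \bigcup_(v in D) (F @^-1` [set v]).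
Proof.
apply/seteqP; split=> x; first by move=> Dx; exists (F x).
by case=> v Dv Fv; rewrite /preimage/= Fv.
Qed.

Lemma mlabel_pre V (F : T -> V) (D : set V) : mlabel F -> measurable (F @^-1` D).
Proof.
move=> mF; rewrite preimage_bigcup1.
by apply: fin_bigcup_measurable => //; exact: finite_finset.
Qed.

Lemma mlabel_comp V W (f : V -> W) (F : T -> V) : mlabel F -> mlabel (f \o F).
Proof. by move=> mF w; rewrite comp_preimage; exact: mlabel_pre. Qed.

Lemma mlabel_pair V W (F : T -> V) (G : T -> W) :
  mlabel F -> mlabel G -> mlabel (fun x => (F x, G x)).
Proof.
move=> mF mG [v w].
rewrite (_ : _ @^-1` _ = F @^-1` [set v] `&` G @^-1` [set w]).
  exact: measurableI.
by apply/seteqP; split=> x /= [-> ->].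
Qed.

Lemma mlabel_ffun (J : finType) V (F : J -> T -> V) :
  (forall i, mlabel (F i)) -> mlabel (fun x => [ffun i => F i x]).
Proof.
move=> mF w.
rewrite (_ : _ @^-1` _ = \bigcap_(i in setT) (F i @^-1` [set w i])).
  by apply: fin_bigcap_measurable => [|i _]; [exact: finite_finset|exact: mF].
apply/seteqP; split=> x /=.
  by move=> <- i _ /=; rewrite ffunE.
by move=> h; apply/ffunP => i; rewrite ffunE; exact: (h i I).
Qed.

Lemma fine_mu_ge0 (E : set T) : 0 <= fine (mu E).
Proof. exact: fine_ge0. Qed.

Lemma fine_muK (E : set T) : measurable E -> (fine (mu E))%:E = mu E.
Proof. by move=> mE; rewrite fineK// fin_num_measure. Qed.

Lemma law_ge0 V (F : T -> V) v : 0 <= law F v.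
Proof. exact: fine_mu_ge0. Qed.

Lemma law_pre V (F : T -> V) (D : pred V) : mlabel F ->
  fine (mu (F @^-1` [set v | D v])) = \sum_(v | D v) law F v.
Proof.
move=> mF; rewrite preimage_bigcup1.
have tF : trivIset [set v | D v] (fun v => F @^-1` [set v]).
  by move=> v w _ _ [x [/= <- <-]].
rewrite (measure_fin_bigcup mu finite_finset tF (fun v _ => mF v)).
rewrite -(@bigfs _ _ _ V (index_enum V) D) ?index_enum_uniq//; last first.
  by move=> v _; rewrite mem_index_enum.
rewrite (eq_bigr (fun v => (law F v)%:E)) => [|v _]; last by rewrite fine_muK.
by rewrite sumEFin.
Qed.

Lemma law_sum1 V (F : T -> V) : mlabel F -> \sum_v law F v = 1.
Proof.
move=> mF; rewrite -(law_pre xpredT mF) (_ : _ @^-1` _ = setT).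
  by rewrite probability_setT.
by apply/seteqP.
Qed.

Lemma law_push V W (f : V -> W) (F : T -> V) : mlabel F ->
  law (f \o F) = image_law f (law F).
Proof.
move=> mF; apply/funext => w; rewrite /image_law -(law_pre (fun v => f v == w) mF).
by congr (fine (mu _)); apply/seteqP; split=> x /= /eqP.
Qed.

Lemma Hlaw_comp V W (f : V -> W) (F : T -> V) : mlabel F -> Hlaw (f \o F) <= Hlaw F.
Proof.
by move=> mF; rewrite /Hlaw law_push//; apply: entropy_push => v; exact: law_ge0.
Qed.

Lemma Hlaw_pair V W (F : T -> V) (G : T -> W) : mlabel F -> mlabel G ->
  Hlaw (fun x => (F x, G x)) <= Hlaw F + Hlaw G.
Proof.
move=> mF mG; have m := mlabel_pair mF mG.
apply: (le_trans (entropy_pair (law_ge0 _) (law_sum1 m))).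
by rewrite -!law_push.
Qed.

Lemma Hlaw_ge0 V (F : T -> V) : mlabel F -> 0 <= Hlaw F.
Proof.
move=> mF; apply: entropy_ge0 => v; rewrite law_ge0/=.
rewrite -(law_sum1 mF) (bigD1 v)//= lerDl sumr_ge0// => *; exact: law_ge0.
Qed.

End Labels.

Section Dynamics.
Context (d : measure_display) (T : measurableType d) (R : realType).
Variable mu : probability T R.
Variable S : T -> T.
Hypothesis mS : forall E, measurable E -> measurable (S @^-1` E).
Hypothesis muS : forall E, measurable E -> mu (S @^-1` E) = mu E.
Implicit Types V W : finType.

Definition itinerary V (F : T -> V) n (x : T) : {ffun 'I_n -> V} :=
  [ffun i : 'I_n => F (iter i S x)].

Lemma measurable_iter n E : measurable E -> measurable (iter n S @^-1` E).
Proof. by elim: n E => // n IH E mE; exact: (IH (S @^-1` E) (mS mE)). Qed.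

Lemma mu_iter n E : measurable E -> mu (iter n S @^-1` E) = mu E.
Proof.
elim: n E => // n IH E mE.
by rewrite -[RHS](muS mE) -(IH _ (mS mE)).
Qed.

Lemma mlabel_iter V (F : T -> V) n : mlabel F -> mlabel (F \o iter n S).
Proof. by move=> mF v; rewrite comp_preimage; apply: measurable_iter. Qed.

Lemma mlabel_itinerary V (F : T -> V) n : mlabel F -> mlabel (itinerary F n).
Proof. by move=> mF; apply: mlabel_ffun => i; exact: (mlabel_iter i mF). Qed.

Arguments mlabel_iter {V F} n mF.
Arguments mlabel_itinerary {V F} n mF.

Lemma Hlaw_iter V (F : T -> V) n : mlabel F -> Hlaw mu (F \o iter n S) = Hlaw mu F.
Proof.
move=> mF; rewrite /Hlaw; congr entropy; apply/funext => v.
by rewrite /law comp_preimage mu_iter.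
Qed.

Lemma Hlaw_itineraryD V (F : T -> V) m n : mlabel F ->
  Hlaw mu (itinerary F (m + n)) <= Hlaw mu (itinerary F m) + Hlaw mu (itinerary F n).
Proof.
move=> mF.
pose g (w : {ffun 'I_m -> V} * {ffun 'I_n -> V}) : {ffun 'I_(m + n) -> V} :=
  [ffun i : 'I_(m + n) => match fintype.split i with inl j => w.1 j | inr j => w.2 j end].
rewrite (_ : itinerary F (m + n) =
    g \o (fun x => (itinerary F m x, (itinerary F n \o iter m S) x))); last first.
  apply/funext => x; apply/ffunP => i; rewrite !ffunE.
  by case: splitP => j ->; rewrite ffunE//= addnC iterD.
have m1 := @mlabel_itinerary _ F m mF; have m2 := @mlabel_itinerary _ F n mF.
have m3 := mlabel_iter m m2.
apply: (le_trans (Hlaw_comp _ _ (mlabel_pair m1 m3))).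
by apply: (le_trans (Hlaw_pair _ m1 m3)); rewrite Hlaw_iter.
Qed.

Lemma Hlaw_itinerary0 V (F : T -> V) : mlabel F -> Hlaw mu (itinerary F 0) = 0.
Proof.
move=> mF; apply/eqP; rewrite eq_le Hlaw_ge0 ?andbT; last exact: mlabel_itinerary.
have := entropy_card (D := [set: {ffun 'I_0 -> V}])
  (law_ge0 mu (itinerary F 0)) (law_sum1 _ (mlabel_itinerary _ mF)).
by rewrite cardsT card_ffun card_ord expn0 ln1; apply => v; rewrite inE.
Qed.

Lemma Hlaw_itineraryM V (F : T -> V) q n : mlabel F ->
  Hlaw mu (itinerary F (q * n)) <= q%:R * Hlaw mu (itinerary F n).
Proof.
move=> mF; elim: q => [|q IH]; first by rewrite mul0n mul0r Hlaw_itinerary0.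
rewrite mulSn -natr1 mulrDl mul1r addrC.
by apply: (le_trans (Hlaw_itineraryD _ _ mF)); rewrite lerD2l.
Qed.

Lemma Hlaw_itinerary1 V (F : T -> V) : mlabel F ->
  Hlaw mu (itinerary F 1) <= Hlaw mu F.
Proof.
move=> mF; rewrite (_ : itinerary F 1 = (fun v => [ffun=> v]) \o F).
  exact: (Hlaw_comp mu _ mF).
by apply/funext => x; apply/ffunP => i; rewrite !ffunE ord1.
Qed.

(** E records where P and Q differ and what P is there, so the itinerary of P can be
    recovered from those of Q and E. This replaces conditional entropy: a small
    error is a label of small entropy. *)
Lemma Hlaw_perturb V (P Q : T -> V) n : mlabel P -> mlabel Q ->
  let E x := if P x == Q x then None else Some (P x) in
  mlabel E /\
  Hlaw mu (itinerary P n) <= Hlaw mu (itinerary Q n) + n%:R * Hlaw mu E.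
Proof.
move=> mP mQ E.
have mE : mlabel E.
  exact: (mlabel_comp (fun v => if v.1 == v.2 then None else Some v.1)
                      (mlabel_pair mP mQ)).
split=> //.
rewrite (_ : itinerary P n = (fun w : {ffun 'I_n -> V} * {ffun 'I_n -> option V} =>
    [ffun i => odflt (w.1 i) (w.2 i)]) \o (fun x => (itinerary Q n x, itinerary E n x))).
  have m1 := @mlabel_itinerary _ Q n mQ; have m2 := @mlabel_itinerary _ E n mE.
  apply: (le_trans (Hlaw_comp _ _ (mlabel_pair m1 m2))).
  apply: (le_trans (Hlaw_pair _ m1 m2)); rewrite lerD2l.
  have := Hlaw_itineraryM n 1 mE; rewrite muln1 => h; apply: (le_trans h).
  by rewrite ler_wpM2l// Hlaw_itinerary1.
apply/funext => x; apply/ffunP => i; rewrite !ffunE /E.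
by case: eqP.
Qed.

(** Every finite measurable partition, moved by a power of S, is close in measure to
    one that can be read off finitely many symbols of the itinerary of G. The power
    K lets forward itineraries stand for two-sided windows. *)
Definition generates W (G : T -> W) := forall V (P : T -> V) (e : R), mlabel P ->
  0 < e -> exists K L (f : {ffun 'I_L -> W} -> V),
    fine (mu [set x | P (iter K S x) != f (itinerary G L x)]) <= e.

(** The limit of a divergent sequence is 0 by convention, so that convergence need
    not be discussed. *)
Lemma limn_le_affine (u : nat -> R) (a c : R) : 0 <= a ->
  (forall n, (0 < n)%N -> u n <= a + c / n%:R) -> limn u <= a.
Proof.
move=> a0 h; have [cu|dv] := pselect (cvgn u); last by rewrite dvgP.
have ca : (fun n : nat => a + c / n%:R) @ \oo --> a.
  rewrite -[X in _ --> X]addr0; apply: cvgD; first exact: cvg_cst.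
  rewrite -[X in _ --> X](mulr0 c); apply: cvgM; first exact: cvg_cst.
  apply/gtr0_cvgV0; last exact: cvgr_idn.
  by exists 1%N => // n /= n1; rewrite ltr0n.
rewrite -(cvg_lim _ ca)//; apply: ler_lim => //; first by apply/cvg_ex; exists a.
by exists 1%N => // n /= n1; exact: h.
Qed.

(** One half of the Kolmogorov-Sinai theorem. Replace P, moved by S^K, by a label Q that
    is a function of L symbols of G, at the cost of an error label of entropy at most
    e. The first n symbols of Q are read off n + L symbols of G, hence off about n / N
    blocks of length N, and entropy is subadditive over blocks. *)
Lemma Hlaw_generator W V (G : T -> W) (P : T -> V) N :
  mlabel G -> generates G -> mlabel P -> (0 < N)%N ->
  limn (fun n => Hlaw mu (itinerary P n) / n%:R) <= Hlaw mu (itinerary G N) / N%:R.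
Proof.
move=> mG gG mP N0.
have HG0 : 0 <= Hlaw mu (itinerary G N) by apply: Hlaw_ge0; exact: mlabel_itinerary.
apply/ler_addgt0Pr => e e0.
have [dl dl0 small] := entropy_small (option V) e0.
have [K [L [f fP]]] := gG _ _ _ mP dl0.
have mQ : mlabel (f \o itinerary G L) by apply: mlabel_comp; exact: mlabel_itinerary.
have mPK := mlabel_iter K mP.
apply: (@limn_le_affine _ _ (((L + N)%:R / N%:R) * Hlaw mu (itinerary G N))).
  by rewrite addr_ge0// ?divr_ge0// ltW.
move=> n n0.
pose E x := if (P \o iter K S) x == (f \o itinerary G L) x
  then None else Some ((P \o iter K S) x).
have [mE HE] : mlabel E /\ _ := Hlaw_perturb n mPK mQ; rewrite -/E in HE.
have HEe : Hlaw mu E <= e.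
  apply: (small _ None (law_ge0 _ _) (law_sum1 _ mE)).
  have mN : measurable (E @^-1` [set None]) := mE None.
  have : mu (~` (E @^-1` [set None])) = (1 - mu (E @^-1` [set None]))%E.
    exact: probability_setC.
  move/(congr1 fine); rewrite fineB//=; last exact: fin_num_measure.
  rewrite -/(law mu E None) => <-.
  apply: le_trans fP; rewrite le_eqVlt; apply/orP; left; apply/eqP.
  congr (fine (mu _)); apply/seteqP; split=> x /=; rewrite /E /=.
    by case: eqP.
  by case: eqP.
have HPK : Hlaw mu (itinerary (P \o iter K S) n) = Hlaw mu (itinerary P n).
  rewrite -(Hlaw_iter K (mlabel_itinerary n mP)); congr (Hlaw mu _).
  by apply/funext => x; apply/ffunP => i; rewrite !ffunE /= -!iterD addnC.
pose q := ((n + L) %/ N).+1.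
have HQ : Hlaw mu (itinerary (f \o itinerary G L) n) <= q%:R * Hlaw mu (itinerary G N).
  have nL : (n + L <= q * N)%N by rewrite ltnW// ltn_ceil.
  apply: (le_trans _ (Hlaw_itineraryM q N mG)).
  have mI := mlabel_itinerary (q * N) mG.
  have lt (i : 'I_n) (j : 'I_L) : (i + j < q * N)%N.
    apply: leq_trans nL; rewrite -addSn leq_add// ltnW//.
  rewrite (_ : itinerary (f \o itinerary G L) n =
    (fun w : {ffun 'I_(q * N) -> W} =>
       [ffun i : 'I_n => f [ffun j : 'I_L => w (Ordinal (lt i j))]])
    \o itinerary G (q * N)); first exact: (Hlaw_comp mu _ mI).
  apply/funext => x; apply/ffunP => i; rewrite !ffunE /=; congr f.
  by apply/ffunP => j; rewrite !ffunE /= addnC iterD.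
have qle : q%:R <= n%:R / N%:R + (L + N)%:R / N%:R :> R.
  rewrite -mulrDl ler_pdivlMr ?ltr0n// -natrD -natrM ler_nat.
  by rewrite mulSn addnA addnC leq_add2r leq_trunc_div.
rewrite ler_pdivrMr ?ltr0n// !mulrDl divfK ?pnatr_eq0 -?lt0n//.
rewrite -HPK; apply: (le_trans HE).
apply: (@le_trans _ _
  ((n%:R / N%:R + (L + N)%:R / N%:R) * Hlaw mu (itinerary G N) + n%:R * e)).
  by rewrite lerD ?ler_wpM2l// (le_trans HQ)// ler_wpM2r.
by rewrite le_eqVlt; apply/orP; left; apply/eqP; ring.
Qed.
End Dynamics.

(** * Borel sets of a shift space *)

Section Borel.
Variables (A : finType) (X : subshift A).
Local Notation T := (borel (points X)).

Lemma open_borel (U : set (points X)) : open U -> measurable (U : set T).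
Proof. exact: sub_sigma_algebra. Qed.

(** For varying k, these are the clopen sets. *)
Definition plocal k (D : set (points X)) :=
  forall x y : points X, agree k (val x) (val y) -> D x -> D y.

Lemma plocal_le k l D : (k <= l)%N -> plocal k D -> plocal l D.
Proof. by move=> kl h x y /(agree_le kl); apply: h. Qed.

Lemma plocalC k D : plocal k D -> plocal k (~` D).
Proof. by move=> h x y xy nDx Dy; apply: nDx; apply: h Dy; apply: agree_sym. Qed.

Lemma plocalU k D E : plocal k D -> plocal k E -> plocal k (D `|` E).
Proof. by move=> h g x y xy [/(h _ _ xy)|/(g _ _ xy)]; [left|right]. Qed.

Lemma plocal_open k D : plocal k D -> open D.
Proof. by move=> h; apply/points_open => x Dx; exists k => y /h; apply. Qed.

Lemma plocal_measurable k D : plocal k D -> measurable (D : set T).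
Proof. by move=> h; exact: (open_borel (plocal_open h)). Qed.

Variables (R : realType) (mu : probability T R).
Local Open Scope ereal_scope.

Definition symd (E D : set T) : set T := (E `\` D) `|` (D `\` E).

Definition approximable (E : set T) := measurable E /\
  forall e : R, (0 < e)%R -> exists k (D : set T), plocal k D /\ mu (symd E D) <= e%:E.

Lemma measurable_symd E D : measurable E -> measurable D -> measurable (symd E D).
Proof. by move=> mE mD; apply: measurableU; exact: measurableD. Qed.

Lemma approx_local k D : plocal k D -> approximable D.
Proof.
move=> h; split=> [|e e0]; first exact: plocal_measurable h.
exists k, D; split=> //; by rewrite /symd setDv setU0 measure0 lee_fin ltW.
Qed.

Lemma approxC E : approximable E -> approximable (~` E).
Proof.
case=> mE h; split=> [|e /h[k [D [lD muD]]]]; first exact: measurableC.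
exists k, (~` D); split; first exact: plocalC.
suff -> : symd (~` E) (~` D) = symd E D by [].
by rewrite /symd !setDE !setCK setUC; congr (_ `|` _); rewrite setIC.
Qed.

Lemma approxU E F : approximable E -> approximable F -> approximable (E `|` F).
Proof.
move=> [mE hE] [mF hF]; split=> [|e e0]; first exact: measurableU.
have e2 : (0 < e / 2)%R by rewrite divr_gt0.
have [k [D [lD muD]]] := hE _ e2; have [l [C [lC muC]]] := hF _ e2.
exists (maxn k l), (D `|` C); split.
  by apply: plocalU; [apply: plocal_le lD|apply: plocal_le lC]; rewrite ?leq_maxl ?leq_maxr.
have mD := plocal_measurable lD; have mC := plocal_measurable lC.
have m1 := measurable_symd mE mD; have m2 := measurable_symd mF mC.
apply: (@le_trans _ _ (mu (symd E D `|` symd F C))).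
  apply: le_measure; rewrite ?inE; [| |].
  - by apply: measurable_symd; exact: measurableU.
  - exact: measurableU.
  - move=> x; rewrite /symd /=; tauto.
apply: (le_trans (measureU2 _ m1 m2)).
by rewrite [e]splitr EFinD; exact: leeD.
Qed.

Lemma approx_nondecreasing (E : (set T)^nat) : (forall n, approximable (E n)) ->
  nondecreasing_seq E -> approximable (\bigcup_n E n).
Proof.
move=> aE ndE; have mE n : measurable (E n) by case: (aE n).
have mU : measurable (\bigcup_n E n) by exact: bigcup_measurable.
split=> // e e0; have e2 : (0 < e / 2)%R by rewrite divr_gt0.
have cE := nondecreasing_cvg_mu (mu := mu) mE mU ndE.
have {}cE : fine (mu (E n)) @[n --> \oo] --> fine (mu (\bigcup_n E n)).
  by apply: fine_cvg; rewrite fine_muK.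
have lt : (fine (mu (\bigcup_n E n)) - e / 2 < fine (mu (\bigcup_n E n)))%R.
  by rewrite ltrBlDr ltrDl.
have [N _ hN] := cvgr_gt _ cE _ lt.
have {hN} := hN N (leqnn _); rewrite /= => hN.
have [k [D [lD muD]]] := (aE N).2 _ e2.
exists k, D; split => //.
have mD := plocal_measurable lD.
have m1 := measurable_symd (mE N) mD.
have m2 : measurable (\bigcup_n E n `\` E N) by exact: measurableD.
apply: (@le_trans _ _ (mu ((\bigcup_n E n `\` E N) `|` symd (E N) D))).
  apply: le_measure; rewrite ?inE.
  - exact: measurable_symd.
  - exact: measurableU.
  - move=> x [[Ux nDx]|[Dx nUx]].
      by have [ENx|nENx] := pselect (E N x); [right; left|left].
    by right; right; split => // ENx; apply: nUx; exists N.
apply: (le_trans (measureU2 _ m2 m1)).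
rewrite [e]splitr EFinD; apply: leeD => //.
rewrite measureD//; last by rewrite -ge0_fin_numE// fin_num_measure.
rewrite setIC setIidl; last exact: bigcup_sup.
suff h : mu (\bigcup_n E n) - mu (E N) <= (e / 2)%:E by exact: h.
by rewrite -(fine_muK mu mU) -(fine_muK mu (mE N)) -EFinB lee_fin lerBlDr -lerBlDl ltW.
Qed.

Lemma approx_open (U : set (points X)) : open U -> approximable U.
Proof.
move=> oU; pose E k : set T :=
  [set x : points X | [set y : points X | agree k (val x) (val y)] `<=` U].
have -> : (U : set T) = \bigcup_k E k.
  apply/seteqP; split=> [x Ux|x [k _ Ek]].
    by have [k kU] := (points_open U).1 oU x Ux; exists k.
  by apply: Ek => /=; exact: agree_refl.
apply: approx_nondecreasing => [k|k l kl].
  apply: (@approx_local k) => x y xy Ex z yz; apply: Ex => /=.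
  exact: agree_trans xy yz.
by apply/subsetPset => x Ex y xy; apply: Ex => /=; exact: agree_le xy.
Qed.

(** The approximable sets form a sigma-algebra. It contains the open sets, since an
    open set is an increasing union of sets seen through growing windows. *)
Lemma measurable_approx (E : set T) : measurable E -> approximable E.
Proof.
move=> mE; apply: (smallest_sub _ _ mE); last exact: approx_open.
split.
- by apply: (@approx_local 0%N).
- by move=> F aF; rewrite setTD; exact: approxC.
- move=> F aF; rewrite -bigcup_bigsetU_bigcup.
  apply: approx_nondecreasing => [n|]; last first.
    apply/nondecreasing_seqP => n; rewrite [leRHS]big_ord_recr.
    by apply/subsetPset => x; left.
  elim: n.+1 => [|m IH]; first by rewrite big_ord0; apply: (@approx_local 0%N).
  by rewrite big_ord_recr; apply: approxU.
Qed.

End Borel.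

Lemma continuous_borel (A B : finType) (X : subshift A) (Y : subshift B)
    (f : points X -> points Y) (E : set (borel (points Y))) :
  continuous f -> measurable E -> measurable (f @^-1` E : set (borel (points X))).
Proof.
move=> cf mE.
pose m := [set F : set (points Y) | measurable (f @^-1` F : set (borel (points X)))].
suff : m E by [].
apply: (smallest_sub _ _ mE); last first.
  by move=> U oU; apply: open_borel; move/continuousP: cf; apply.
split.
- by rewrite /m /= preimage_set0.
- by move=> F mF; rewrite /m /= setTD preimage_setC; apply: measurableC.
- by move=> F mF; rewrite /m /= preimage_bigcup; apply: bigcup_measurable => n _; exact: (mF n).
Qed.

Lemma sigma_continuous (A : finType) (X : subshift A) : continuous (@sigma A X).
Proof.
apply/continuousP => U /points_open oU; apply/points_open => x /oU[k kU].
exists k.+1 => y xy; apply: kU => i ik /=; rewrite /shift_map; apply: xy; lia.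
Qed.

(** Approximate each piece of a Borel partition by a set seen through a finite window,
    and put x in the first approximating set that contains it: the new partition is
    wrong only on the symmetric differences. *)
Lemma coordinate_generates (A : finType) (X : subshift A) (R : realType)
    (mu : probability (borel (points X)) R) (W : finType) (G : points X -> W) :
  invariant_under mu (@sigma A X) ->
  (forall x y : points X, G x = G y <-> val x 0 = val y 0) ->
  generates (mu : probability (borel (points X)) R) (@sigma A X) G.
Proof.
move=> muS GG V P e mP e0.
have mS E : measurable (E : set (borel (points X))) ->
    measurable (@sigma A X @^-1` E : set (borel (points X))).
  exact: continuous_borel (@sigma_continuous A X).
pose n : R := #|V|%:R + 1.
have n0 : 0 < n by rewrite ltr_wpDl.
have en0 : 0 < e / n by rewrite divr_gt0.
have /choice[kD kDP] v : exists kD : nat * set (borel (points X)),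
    plocal kD.1 kD.2 /\ (mu (symd (P @^-1` [set v]) kD.2) <= (e / n)%:E)%E.
  by have [k [D h]] := (measurable_approx mu (mP v)).2 _ en0; exists (k, D).
pose K := (\max_v (kD v).1)%N.
have lD v : plocal K (kD v).2.
  by apply: plocal_le (kDP v).1; exact: (leq_bigmax (F := fun v => (kD v).1)).
pose v0 := P point.
pose Q (x : points X) := odflt v0 [pick v | `[<(kD v).2 x>]].
have lQ (x y : points X) : agree K (val x) (val y) -> Q x = Q y.
  move=> xy; congr odflt; apply: eq_pick => v; apply/asbool_equiv_eq.
  by split; apply: lD => //; exact: agree_sym.
have bad : [set x | P x != Q x] `<=`
    \bigcup_(v in [set` xpredT]) symd (P @^-1` [set v]) (kD v).2.
  move=> x /eqP PQ; apply: contrapT => h; apply: PQ.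
  have PD v : P x = v <-> (kD v).2 x.
    split=> [Pv|Dv]; apply: contrapT => nv; apply: h; exists v => //.
      by left; split.
    by right; split.
  rewrite /Q; case: pickP => [v /asboolP/PD//|/(_ (P x))/asboolP[]].
  exact/PD.
have mbad v : measurable (symd (P @^-1` [set v]) (kD v).2).
  apply: measurable_symd; [exact: mP|exact: plocal_measurable (lD v)].
have mQ : mlabel (Q : borel (points X) -> V).
  move=> v; apply: (@plocal_measurable _ _ K) => x y xy /= <-.
  by rewrite (lQ _ _ xy).
have mPQ : measurable ([set x | P x != Q x] : set (borel (points X))).
  exact: (mlabel_pre [set u | u.1 != u.2] (mlabel_pair mP mQ)).
have muPQ : (mu [set x | P x != Q x] <= e%:E)%E.
  apply: (@le_trans _ _ (\sum_(v \in [set` xpredT]) mu (symd (P @^-1` [set v]) (kD v).2))%E).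
    exact: (content_sub_fsum _ finite_finset (fun v _ => mbad v) mPQ bad).
  rewrite -(@bigfs _ _ _ V (index_enum V)) ?index_enum_uniq//; last first.
    by move=> v _; rewrite mem_index_enum.
  apply: (@le_trans _ _ (\sum_(v : V) (e / n)%:E)%E).
    by apply: lee_sum => v _; exact: (kDP v).2.
  rewrite sumEFin lee_fin sumr_const -[leLHS]mulr_natr mulrAC ler_pdivrMr//.
  by rewrite ler_pM2l// lerDl.
pose L := (2 * K).+1.
pose it := @itinerary _ (borel (points X)) (@sigma A X) W G L.
pose f w := if pselect (exists y, it y = w) is left h
  then Q (iter K (@sigma A X) (projT1 (cid h))) else v0.
exists K, L, f.
rewrite (_ : [set x | _] = iter K (@sigma A X) @^-1` [set x | P x != Q x]).
  rewrite mu_iter//; apply: le_trans (_ : fine e%:E <= _) => //.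
  by rewrite fine_le// fin_num_measure.
apply/seteqP; suff h x : f (it x) = Q (iter K (@sigma A X) x).
  by split=> x /=; rewrite -/it h.
rewrite /f; case: pselect => [h|[]]; last by exists x.
case: cid => y /= yx; apply: lQ; rewrite !val_sigma_iter => i iK.
have jL : (`|(i + K%:Z)%R|%N < L)%N by rewrite /L; lia.
have := congr1 (fun w : {ffun 'I_L -> W} => w (Ordinal jL)) yx.
rewrite !ffunE /= => /GG; rewrite !val_sigma_iter /shiftz.
by have -> : 0 + `|(i + K%:Z)%R|%N%:Z = i + K%:Z by lia.
Qed.

(** * Topological entropy as the growth of the language *)

Lemma leastP (P : set nat) k : P k ->
  P (least P) /\ (forall j, P j -> (least P <= j)%N).
Proof.
move=> Pk; rewrite /least; case: xgetP => [n _ []//|].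
have ex : exists n, `[<P n>] by exists k; apply/asboolP.
case: (ex_minnP ex) => m /asboolP Pm mP /(_ m) [].
by split=> // j /asboolP; apply: mP.
Qed.

Lemma least_eq (P : set nat) k : P k -> (forall j, P j -> (k <= j)%N) -> least P = k.
Proof.
move=> Pk kP; have [Pl lP] := leastP Pk.
by apply/eqP; rewrite eqn_leq lP// kP.
Qed.

Section Fekete.
Variables (R : realType) (a : nat -> R).
Hypothesis a0 : forall n, 0 <= a n.
Hypothesis aD : forall m n, a (m + n)%N <= a m + a n.

Lemma subadditive_divn N : (0 < N)%N ->
  exists c, forall n, (0 < n)%N -> a n / n%:R <= a N / N%:R + c / n%:R.
Proof.
move=> N0; exists (\sum_(r < N) a r) => n n0.
have aM q r : a (q * N + r)%N <= q%:R * a N + a r.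
  elim: q => [|q IH]; first by rewrite mul0r add0r.
  rewrite mulSn -addnA -natr1 mulrDl mul1r [_ * _ + _]addrC -addrA.
  by apply: (le_trans (aD _ _)); rewrite lerD2l.
rewrite ler_pdivrMr ?ltr0n// mulrDl divfK ?pnatr_eq0 -?lt0n//.
rewrite [X in a X](divn_eq n N); apply: (le_trans (aM _ _)); apply: lerD.
  rewrite mulrAC -mulrA [leLHS]mulrC ler_wpM2l// ler_pdivlMr ?ltr0n// -natrM.
  by rewrite ler_nat leq_trunc_div.
have rN : (n %% N < N)%N by rewrite ltn_mod.
by rewrite (bigD1 (Ordinal rN))//= lerDl sumr_ge0.
Qed.

(** Choose a block length N that nearly attains the infimum and cut [0, n) into blocks
    of length N. *)
Lemma fekete : exists2 h : R, a n / n%:R @[n --> \oo] --> h &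
  forall n, (0 < n)%N -> h <= a n / n%:R.
Proof.
pose E := [set a n / n%:R | n in [set n | (0 < n)%N]].
have lbE : lbound E 0 by move=> _ [n _ <-]; rewrite divr_ge0.
have hE : has_inf E by split; [exists (a 1%N / 1%:R), 1%N|exists 0].
exists (inf E) => [|n n0]; last by apply: ge_inf; [exists 0|exists n].
apply/cvgrPdist_le => e e0.
have e2 : 0 < e / 2 by rewrite divr_gt0.
have [_ [N /= N0 <-] hN] := inf_adherent e2 hE.
have [c hc] := subadditive_divn N0.
have cc : c / n%:R @[n --> \oo] --> (0 : R).
  rewrite -[X in _ --> X](mulr0 c); apply: cvgM; first exact: cvg_cst.
  apply/gtr0_cvgV0; last exact: cvgr_idn.
  by exists 1%N => // n /= n1; rewrite ltr0n.
have [M _ hM] := cvgr_lt _ cc _ e2.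
exists (maxn M 1) => // n; rewrite /= geq_max => /andP[Mn n1].
have lo : inf E <= a n / n%:R by apply: ge_inf; [exists 0|exists n].
rewrite distrC ger0_norm ?subr_ge0// lerBlDl.
apply: (le_trans (hc n n1)); apply: le_trans (_ : (inf E + e / 2) + e / 2 <= _).
  by apply: lerD; apply/ltW => //; exact: hM.
by rewrite -addrA -splitr.
Qed.
End Fekete.

Section Language.
Variables (A : finType) (X : subshift A).

Definition lang N : {set {ffun 'I_N -> A}} :=
  [set w : {ffun 'I_N -> A} | `[< exists x : points X, forall i : 'I_N, val x i%:Z = w i >]].

Lemma langP N (w : {ffun 'I_N -> A}) :
  reflect (forall j, exists x : points X, forall i : 'I_N, val x (j + i%:Z) = w i)
          (w \in lang N).
Proof.
rewrite inE; apply: (iffP (asboolP _)) => [[x xw] j|/(_ 0)[x xw]].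
  exists (pshift (- j) x) => i; rewrite -xw /= /shiftz; congr (val x _); lia.
by exists x => i; rewrite -xw add0r.
Qed.

Lemma lang_gt0 N : (0 < #|lang N|)%N.
Proof.
apply/card_gt0P; exists [ffun i : 'I_N => val (point : points X) i%:Z].
by rewrite inE; apply/asboolP; exists point => i; rewrite ffunE.
Qed.

Lemma lang_leqD m n : (#|lang (m + n)| <= #|lang m| * #|lang n|)%N.
Proof.
rewrite -cardsX; pose f (w : {ffun 'I_(m + n) -> A}) :=
  ([ffun i => w (lshift n i)], [ffun i => w (rshift m i)]).
have injf : {in lang (m + n) &, injective f}.
  move=> w v _ _ [/ffunP wv1 /ffunP wv2].
  apply/ffunP => i; rewrite -(splitK i); case: (fintype.split i) => j /=.
    by have := wv1 j; rewrite !ffunE.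
  by have := wv2 j; rewrite !ffunE.
rewrite -(card_in_imset injf).
apply/subset_leq_card/fintype.subsetP => _ /imsetP[w /langP wL ->].
rewrite inE; apply/andP; split; apply/langP => j.
  by have [x xw] := wL j; exists x => i; rewrite ffunE -xw.
have [x xw] := wL (j - m%:Z); exists x => i; rewrite ffunE -xw /=.
by congr (val x _); lia.
Qed.

Variable R : realType.

Definition lnlang n : R := ln #|lang n|%:R.

Lemma lnlang_ge0 n : 0 <= lnlang n.
Proof. by rewrite ln_ge0// ler1n lang_gt0. Qed.

Lemma lnlangD m n : lnlang (m + n) <= lnlang m + lnlang n.
Proof.
rewrite -lnM ?posrE ?ltr0n ?lang_gt0// ler_ln ?posrE -?natrM ?ltr0n ?muln_gt0 ?lang_gt0//.
by rewrite ler_nat lang_leqD.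
Qed.

Definition hlang : R := limn (fun n => lnlang n / n%:R).

Lemma hlang_cvg : lnlang n / n%:R @[n --> \oo] --> hlang.
Proof.
have [h hc _] := fekete lnlang_ge0 lnlangD.
by apply/cvg_ex; exists h.
Qed.

Lemma hlang_le n : (0 < n)%N -> hlang <= lnlang n / n%:R.
Proof.
have [h hc hle] := fekete lnlang_ge0 lnlangD.
by rewrite /hlang (cvg_lim _ hc)//; exact: hle.
Qed.

Local Notation T := (points X).

(** Distinct words of length N label disjoint nonempty pieces, so no member of the
    join of the cover by letters can be spared. *)
Lemma cover_number_letters N :
  cover_number (cover_join (@sigma A X)
    (range (fun a => [set x : T | val x 0 = a])) N) = #|lang N|.
Proof.
set U := range _.
have cellP (V : set T) : cover_join (@sigma A X) U N V -> exists w : {ffun 'I_N -> A},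
    V = [set x : T | forall i : 'I_N, val x i%:Z = w i].
  move=> [u [uU ->]].
  have h (i : 'I_N) : exists a, u i = [set x : T | val x 0 = a].
    by have [a _ <-] := uU i (ltn_ord i); exists a.
  have [w wP] := choice h; exists (finfun w).
  apply/seteqP; split=> x hx i.
    have := hx i (ltn_ord i); rewrite /preimage /= wP /= ffunE => <-.
    by rewrite val_sigma_iter /shiftz add0r.
  move=> /= iN; rewrite (wP (Ordinal iN)) /=.
  by rewrite val_sigma_iter /shiftz add0r (hx (Ordinal iN)) ffunE.
apply: least_eq.
  exists (fun j =>
    [set x : T | forall i : 'I_N, val x i%:Z = (enum_val j : {ffun 'I_N -> A}) i]).
  split=> [j|].
    exists (fun i => if pselect (i < N)%N is left h
      then [set x : T | val x 0 = (enum_val j : {ffun 'I_N -> A}) (Ordinal h)] else setT).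
    split=> [i iN|]; first by case: pselect => // h; exists (enum_val j (Ordinal h)).
    apply/seteqP; split=> x /= hx i.
      move=> /= iN; case: pselect => // h.
      by rewrite /= val_sigma_iter /shiftz add0r; exact: (hx (Ordinal h)).
    have := hx i (ltn_ord i); rewrite /=; case: pselect => [h|[]//] /=.
    rewrite val_sigma_iter /shiftz add0r => ->; congr (enum_val j _).
    exact: val_inj.
  apply/seteqP; split=> // x _.
  have xL : [ffun i : 'I_N => val x i%:Z] \in lang N.
    by rewrite inE; apply/asboolP; exists x => i; rewrite ffunE.
  exists (enum_rank_in xL [ffun i : 'I_N => val x i%:Z]) => //= i.
  by rewrite enum_rankK_in// ffunE.
move=> k [V [VU Vcov]].
have inV (x : T) : exists j, V j x.
  have : (\bigcup_j V j) x by rewrite Vcov.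
  by case=> j _; exists j.
have h (w : {ffun 'I_N -> A}) : exists j : option 'I_k, w \in lang N ->
    exists2 j', j = Some j' & exists2 x : T, V j' x & forall i : 'I_N, val x i%:Z = w i.
  have [|_] := boolP (w \in lang N); last by exists None.
  rewrite inE => /asboolP[x xw]; have [j Vj] := inV x.
  by exists (Some j) => _; exists j => //; exists x.
have [f fP] := choice h.
have injf : {in lang N &, injective f}; last first.
  rewrite -[k](card_ord k) -(card_in_imset injf) -cardsT.
  have sI : injective (@Some 'I_k) by move=> ? ? [].
  rewrite -(card_imset _ sI); apply/subset_leq_card/fintype.subsetP.
  move=> _ /imsetP[w wL ->]; have [j -> _] := fP _ wL.
  by apply/imsetP; exists j.
move=> w v wL vL; have [j -> [x Vx xw]] := fP _ wL; have [j' -> [y Vy yv]] := fP _ vL.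
case=> jj; rewrite -jj in Vy; have [u uP] := cellP _ (VU j).
rewrite uP in Vx Vy.
by apply/ffunP => i; rewrite -xw -yv Vx Vy.
Qed.

(** Choose for each word of length N + 2K a point that carries it on [-K, N + K). The
    members of U around its first N iterates also contain the iterates of any other
    point with the same word there. *)
Lemma cover_number_window (U : set (set T)) K N :
  (forall x : T, exists2 V, U V & [set y : T | agree K (val x) (val y)] `<=` V) ->
  (cover_number (cover_join (@sigma A X) U N) <= #|lang (N + 2 * K)|)%N.
Proof.
move=> UK; set L := (N + 2 * K)%N.
have pK (x : T) : exists V, U V /\ [set y : T | agree K (val x) (val y)] `<=` V.
  by have [V ? ?] := UK x; exists V.
have [mem memP] := choice pK.
suff: [set k | exists V : 'I_k -> set T,
    (forall j, cover_join (@sigma A X) U N (V j)) /\ \bigcup_j V j = setT] #|lang L|.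
  by move=> h; exact: ((leastP h).2 _ h).
have hx (j : 'I_#|lang L|) : exists x : T, forall i : 'I_L,
    val x (- K%:Z + i%:Z) = (enum_val j : {ffun 'I_L -> A}) i.
  by have /langP/(_ (- K%:Z)) := enum_valP j.
have [x xP] := choice hx.
exists (fun j => \bigcap_(i in `I_N) (iter i (@sigma A X) @^-1`
   mem (iter i (@sigma A X) (x j)))).
split=> [j|].
  exists (fun i => mem (iter i (@sigma A X) (x j))).
  by split=> // i _; exact: (memP _).1.
apply/seteqP; split=> // y _.
have yL : [ffun i : 'I_L => val y (- K%:Z + i%:Z)] \in lang L.
  rewrite inE; apply/asboolP; exists (pshift (- K%:Z) y) => i.
  by rewrite ffunE /= /shiftz addrC.
exists (enum_rank_in yL [ffun i : 'I_L => val y (- K%:Z + i%:Z)]) => //= i /= iN.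
apply: (memP _).2 => /= l lK; rewrite !val_sigma_iter /shiftz.
have lL : (`|(l + i%:Z + K%:Z)%R|%N < L)%N by rewrite /L; lia.
have -> : l + i%:Z = - K%:Z + (Ordinal lL)%:Z by rewrite /=; lia.
by rewrite xP enum_rankK_in// ffunE.
Qed.

(** The cover by letters has exactly as many pieces as there are words. An arbitrary
    cover can only use a window of radius K around the first n symbols, and these 2K
    additional symbols do not change the growth rate. *)
Theorem top_entropy_lang : top_entropy R (@sigma A X) = hlang%:E.
Proof.
apply/eqP; rewrite eq_le; apply/andP; split.
  apply: ge_ereal_sup => _ [U [oU ->]]; rewrite lee_fin.
  have [K hK] := lebesgue_number oU.
  have key M : (0 < M)%N ->
      limn (fun n => ln (cover_number (cover_join (@sigma A X) U n))%:R / n%:R : R)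
      <= lnlang M / M%:R.
    move=> M0; have [c hc] := subadditive_divn lnlang_ge0 lnlangD M0.
    apply: (@limn_le_affine _ _ _ (c + lnlang (2 * K))).
      by rewrite divr_ge0// lnlang_ge0.
    move=> n n0; rewrite mulrDl addrA.
    apply: le_trans (_ : lnlang n / n%:R + lnlang (2 * K) / n%:R <= _); last first.
      by rewrite lerD2r hc.
    rewrite -mulrDl ler_wpM2r ?invr_ge0//; apply: le_trans (lnlangD _ _).
    rewrite /lnlang; set k := cover_number _.
    have [->|k0] := posnP k; first by rewrite ln0// lnlang_ge0.
    by rewrite ler_ln ?posrE ?ltr0n ?lang_gt0// ler_nat; exact: cover_number_window.
  apply: (cvgr_to_ge hlang_cvg).
  by exists 1%N => // M; exact: key.
apply: ereal_sup_ubound.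
exists (range (fun a => [set x : T | val x 0 = a])); split.
  split=> [_ [a _ <-]|].
    apply/points_open => x <-; exists 0%N => y xy /=; exact/esym/xy.
  by apply/seteqP; split=> // x _; exists [set y : T | val y 0 = val x 0] => //; exists (val x 0).
rewrite /hlang; congr (limn _)%:E.
by apply/funext => n; rewrite cover_number_letters.
Qed.
End Language.

(** * Measures from finitely additive functions of windows *)

Lemma compact_nested (A : finType) (X : subshift A) (C : set (points X))
    (F : (set (points X))^nat) k : plocal k C -> (forall i, exists l, plocal l (F i)) ->
  C `<=` \bigcup_i F i -> exists N, C `<=` \bigcup_(i < N) F i.
Proof.
move=> lC lF CF.
pose P (n : nat) (x : points X) := C x -> (\bigcup_(i < n) F i) x.
have [|n _ /(_ n (leqnn _)) h] :=
  (compact_near_coveringP [set: points X]).1 (@points_compact A X) nat \oo P _.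
  move=> x _; have [Cx|nCx] := pselect (C x).
    have [i _ Fix] := CF x Cx; have [l lFi] := lF i.
    exists ([set y : points X | agree l (val x) (val y)], [set n | (i < n)%N]).
      by split; [apply/points_nbhs; exists l|exists i.+1].
    by case=> y n /= [xy iN] _; exists i => //; exact: lFi xy _.
  exists ([set y : points X | agree k (val x) (val y)], setT).
    by split; [apply/points_nbhs; exists k|exact: filterT].
  by case=> y n /= [xy _] Cy; case: nCx; apply: lC Cy; exact: agree_sym.
by exists n => x; exact: h.
Qed.

Section Windowed.
Variables (A : finType) (X : subshift A).

(** The space of X with the algebra of the sets seen through a finite window, a copy
    of [points X] because the latter carries its Borel structure. *)
Definition windowed : Type := points X.

HB.instance Definition _ := Pointed.on windowed.

Definition windowed_sets : set (set windowed) := [set C | exists k, plocal k C].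

Lemma windowed0 : windowed_sets set0. Proof. by exists 0%N. Qed.

Lemma windowedU : setU_closed windowed_sets.
Proof.
move=> C D [k kC] [l lD]; exists (maxn k l).
by apply: plocalU; [apply: plocal_le kC|apply: plocal_le lD]; rewrite ?leq_maxl ?leq_maxr.
Qed.

Lemma windowedC : setC_closed windowed_sets.
Proof. by move=> C [k kC]; exists k; exact: plocalC. Qed.

Fact windowed_display : measure_display. Proof. exact: default_measure_display. Qed.

HB.instance Definition _ := isAlgebraOfSets.Build windowed_display windowed
  windowed0 windowedU windowedC.

Variables (R : realType) (m : set (points X) -> R).
Hypothesis m_ge0 : forall C, 0 <= m C.
Hypothesis mT : m setT = 1.
Hypothesis mU : forall k C D, plocal k C -> plocal k D -> C `&` D = set0 ->
  m (C `|` D) = m C + m D.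
Local Open Scope ereal_scope.

Definition premeasure (C : set windowed) : \bar R := (m C)%:E.

Lemma m_set0 : m set0 = 0%R.
Proof.
have : m (set0 `|` set0) = (m set0 + m set0)%R by apply: (@mU 0%N) => //; rewrite setI0.
by rewrite setU0 => e; lra.
Qed.

Lemma premeasure0 : premeasure set0 = 0.
Proof. by rewrite /premeasure m_set0. Qed.

Lemma premeasure_ge0 C : 0 <= premeasure C.
Proof. by rewrite lee_fin. Qed.

Lemma m_bigsetU (F : (set windowed)^nat) n : (forall i, windowed_sets (F i)) ->
  trivIset setT F ->
  m (\big[setU/set0]_(i < n) F i) = (\sum_(i < n) m (F i))%R.
Proof.
move=> wF tF; elim: n => [|n IH]; first by rewrite !big_ord0 m_set0.
rewrite !big_ord_recr /= -IH.
have [k kF] : windowed_sets (\big[setU/set0]_(i < n) F i).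
  by elim/big_ind: _ => //; [exact: windowed0|exact: windowedU].
have [l lF] := wF n.
apply: (@mU (maxn k l)).
- by apply: plocal_le kF; rewrite leq_maxl.
- by apply: plocal_le lF; rewrite leq_maxr.
- rewrite -bigcup_mkord; apply/seteqP; split=> // x [[i /= iN Fi] Fn].
  have e : i = n by apply: (tF i n I I); exists x.
  by rewrite e ltnn in iN.
Qed.

(** By compactness, a windowed set that is a disjoint union of windowed sets is the
    union of finitely many of them, the others being empty. *)
Lemma premeasure_sigma_additive : semi_sigma_additive premeasure.
Proof.
move=> F mF tF [k kF].
have [N hN] := compact_nested kF mF (@subset_refl _ _).
have F0 n : (N <= n)%N -> F n = set0.
  move=> Nn; apply/seteqP; split=> // x Fnx.
  have [i /= iN Fix] : (\bigcup_(i < N) F i) x by apply: hN; exists n.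
  have e : i = n by apply: (tF i n I I); exists x.
  by move: iN; rewrite e ltnNge Nn.
have UN : \bigcup_n F n = \big[setU/set0]_(i < N) F i.
  rewrite -bigcup_mkord; apply/seteqP; split=> // x [i _ Fi]; by exists i.
apply: cvg_near_cst; exists N => // n /= Nn.
rewrite /premeasure sumEFin big_mkord -m_bigsetU//; congr (m _)%:E.
rewrite UN -!bigcup_mkord; apply/seteqP; split=> x [i /= iN Fi].
  exists i => //=; rewrite ltnNge; apply/negP => Ni.
  by rewrite F0 in Fi.
by exists i => //=; exact: leq_trans Nn.
Qed.

HB.instance Definition _ := isMeasure.Build windowed_display windowed R premeasure
  premeasure0 premeasure_ge0 premeasure_sigma_additive.

Definition extension : set (borel (points X)) -> \bar R := measure_extension premeasure.

(** The windowed sets generate the Borel sets. *)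
Lemma borel_windowed (E : set (borel (points X))) : measurable E ->
  measurable (E : set (g_sigma_algebraType (@measurable _ windowed))).
Proof.
move=> mE; apply: (smallest_sub _ _ mE).
  exact: smallest_sigma_algebra.
move=> U oU; pose E' k := [set x : points X |
  [set y : points X | agree k (val x) (val y)] `<=` U].
have -> : U = \bigcup_k E' k.
  apply/seteqP; split=> [x Ux|x [k _ Ek]].
    by have [k kU] := (points_open U).1 oU x Ux; exists k.
  by apply: Ek => /=; exact: agree_refl.
apply: (@bigcup_measurable _ (g_sigma_algebraType (@measurable _ windowed))) => k _.
apply: sub_sigma_algebra; exists k => x y xy Ex z yz; apply: Ex => /=.
exact: agree_trans xy yz.
Qed.

Lemma extension0 : extension set0 = 0. Proof. exact: measure0. Qed.
Lemma extension_ge0 E : 0 <= extension E. Proof. exact: measure_ge0. Qed.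
Lemma extension_sigma_additive : semi_sigma_additive extension.
Proof.
move=> F mF tF mUF; rewrite /extension.
apply: (@measure_semi_sigma_additive _ _ _ (measure_extension premeasure)) => //.
  by move=> i; apply: borel_windowed; exact: mF.
exact: borel_windowed.
Qed.

HB.instance Definition _ := isMeasure.Build _ (borel (points X)) R extension
  extension0 extension_ge0 extension_sigma_additive.

Lemma extensionE k C : plocal k C -> extension C = (m C)%:E.
Proof. by move=> kC; apply: measurable_mu_extE; exists k. Qed.

Lemma extensionT : extension setT = 1.
Proof. by rewrite (@extensionE 0%N)// mT. Qed.

HB.instance Definition _ := Measure_isProbability.Build _ _ R extension extensionT.

(** Caratheodory extension of the premeasure given by m. *)
Lemma extend_windowed : exists nu : probability (borel (points X)) R,
  forall k C, plocal k C -> nu C = (m C)%:E.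
Proof. by exists extension; exact: extensionE. Qed.
End Windowed.

(** * SFT covers and the lifting of periodic points *)

Section Avoid.
Variables (A : finType).

Lemma avoid_shiftz (F : set (seq A)) t x : avoid F x -> avoid F (shiftz t x).
Proof. by move=> Fx w Fw /occurs_shift; exact: Fx. Qed.

Lemma avoid_closed (F : set (seq A)) : closed (avoid F).
Proof.
apply/closed_agree => x h w Fw [i wi].
have [y Fy xy] := h (`|i| + size w)%N; apply: (Fy w Fw); exists i.
by rewrite -[RHS]wi; apply/subword_eqP => k kw; rewrite xy//; lia.
Qed.

Lemma shift_map_image (C : set (fullshift A)) :
  (forall t x, C x -> C (shiftz t x)) -> @shift_map A @` C = C.
Proof.
move=> Cs; apply/seteqP; split=> [_ [x Cx <-]|x Cx]; first exact: (Cs 1).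
exists (shiftz (- 1) x); first exact: Cs.
by apply/funext => i; rewrite /shift_map /shiftz addrK.
Qed.

Lemma sft_coverP (X : subshift A) (n : nat) x : sft_cover X n x <->
  forall i l, (l <= n)%N -> language X (subword x i l).
Proof.
split=> [h i l ln|h w [wX wn] [i wi]].
  apply: contrapT => nL; apply: (h (subword x i l)); last exact: occurs_subword.
  by split=> //; rewrite size_subword.
by apply: wX; rewrite -wi; apply: h.
Qed.

Lemma sub_sft_cover (X : subshift A) (n : nat) : carrier X `<=` sft_cover X n.
Proof.
move=> x Xx; apply/sft_coverP => i l _; exists x => //; exact: occurs_subword.
Qed.

Definition cover_subshift (X : subshift A) (n : nat) : subshift A.
Proof.
apply: (@Subshift _ (sft_cover X n)).
- by have [x /sub_sft_cover Xx] := subshift_nonempty X; exists x.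
- exact: avoid_closed.
- by apply: shift_map_image => t x; exact: avoid_shiftz.
Defined.

Definition short_words (f : nat) : set (seq A) := [set w | (size w <= f)%N].

Lemma finite_short_words f : finite_set (short_words f).
Proof.
have := @finite_finset {n : 'I_f.+1 & n.-tuple A} setT.
move/(finite_image (fun u => tval (tagged u) : seq A)); apply: sub_finite_set.
move=> w wf; have wf' : (size w < f.+1)%N by [].
by exists (existT (fun n : 'I_f.+1 => n.-tuple A) (Ordinal wf') (in_tuple w)).
Qed.
End Avoid.

Section ImageSubshift.
Variables (A B : finType) (r : nat) (Phi : seq A -> B).

Lemma block_map_agree k x y : agree (k + r) x y ->
  agree k (block_map r Phi x) (block_map r Phi y).
Proof.
move=> xy i ik; congr Phi; apply/subword_eqP => j jr; apply: xy; lia.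
Qed.

Lemma block_map_continuous : continuous (block_map r Phi).
Proof.
move=> x V /nbhs_agree[k kV]; apply/nbhs_agree; exists (k + r)%N => y xy.
by apply: kV; exact: block_map_agree.
Qed.

Lemma image_closed (X : subshift A) : closed (block_map r Phi @` carrier X).
Proof.
apply/closed_agree => z h.
have cX : compact (carrier X).
  by apply: (@subclosed_compact _ _ setT);
    [exact: subshift_closed|exact: fullshift_compact|].
have cZ : compact (block_map r Phi @` carrier X).
  by apply: continuous_compact => //; exact/continuous_subspaceT/block_map_continuous.
have hF : ProperFilter (filter_from [set: nat]
    (fun k => [set y | (block_map r Phi @` carrier X) y /\ agree k z y])).
  apply: filter_from_proper; last first.
    by move=> k _; have [y Zy zy] := h k; exists y.
  apply: filter_from_filter; first by exists 0%N.
  move=> k l _ _; exists (maxn k l) => // y [Zy zy]; split; split=> //.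
    by apply: agree_le zy; rewrite leq_maxl.
  by apply: agree_le zy; rewrite leq_maxr.
have [|y [Zy cy]] := cZ _ hF; first by exists 0%N => // y [].
suff -> : z = y by [].
apply/funext => i.
have [||w [[_ zw] yw]] := cy [set w | (block_map r Phi @` carrier X) w /\ agree `|i|%N z w]
    (agree `|i|%N y).
- by exists `|i|%N.
- by apply/nbhs_agree; exists `|i|%N.
- by rewrite zw// yw.
Qed.

Definition image_subshift (X : subshift A) : subshift B.
Proof.
apply: (@Subshift _ (block_map r Phi @` carrier X)).
- by have [x Xx] := subshift_nonempty X; exists (block_map r Phi x), x.
- exact: image_closed.
- apply: shift_map_image => t _ [x Xx <-]; rewrite -block_map_shift.
  by exists (shiftz t x) => //; exact: subshift_shift.
Defined.

Lemma block_factor (X : subshift A) (Y : subshift B) :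
  block_map r Phi @` carrier X = carrier Y ->
  exists phi : points X -> points Y, factor_map phi /\
    forall x : points X, val (phi x) = block_map r Phi (val x).
Proof.
move=> XY; have inY (x : points X) : carrier Y (block_map r Phi (val x)).
  by rewrite -XY; exists (val x) => //; exact: pointsP.
exists (fun x => mkpoint (inY x)); split=> //; split.
- move=> x V /points_nbhs[k kV]; apply/points_nbhs; exists (k + r)%N => y xy.
  by apply: kV => /=; exact: block_map_agree.
- move=> y _.
  have [x Xx xy] : (block_map r Phi @` carrier X) (val y) by rewrite XY; exact: pointsP.
  by exists (mkpoint Xx) => //; apply: val_points_inj.
- move=> x; apply: val_points_inj => /=.
  have sE (C : finType) (u : fullshift C) : shift_map u = shiftz 1 u by [].
  by rewrite !sE block_map_shift.
Qed.

Lemma block_map_widen s : (r <= s)%N -> exists Psi : seq A -> B,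
  forall x, block_map r Phi x = block_map s Psi x.
Proof.
move=> rs; exists (fun w => Phi (take (2 * r).+1 (drop (s - r) w))) => x.
apply/funext => t; rewrite /block_map; congr Phi.
apply: (@eq_from_nth _ (x 0)).
  by rewrite size_takel ?size_drop !size_subword//; lia.
move=> i; rewrite size_subword => ir.
rewrite nth_take// nth_drop !nth_mkseq//; last lia.
by congr x; lia.
Qed.
End ImageSubshift.

Section Lifting.
Variables (A B : finType) (X : subshift A) (Y : subshift B).
Variables (r : nat) (Phi : seq A -> B).
Hypothesis XY : block_map r Phi @` carrier X = carrier Y.
Local Notation pi := (block_map r Phi).

Lemma language_lift z i l j : language Y (subword z i l) ->
  exists2 x : fullshift A, carrier X x & subword (pi x) j l = subword z i l.
Proof.
move=> /languageE/(_ j)[y]; rewrite size_subword -XY => -[x Xx <-] e.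
by exists x.
Qed.

Lemma language_image x i l : language X (subword x (i - r%:Z) (l + 2 * r)) ->
  language Y (subword (pi x) i l).
Proof.
move=> /languageE/(_ (i - r%:Z))[x' Xx']; rewrite size_subword => e.
rewrite -(@block_map_local A B r Phi x' x i i l e).
by exists (pi x'); [rewrite -XY; exists x'|exact: occurs_subword].
Qed.

Lemma sub_image_cover n : carrier Y `<=` pi @` sft_cover X n.
Proof.
by rewrite -XY => _ [x Xx <-]; exists x => //; exact: sub_sft_cover.
Qed.

(** A point of X_n avoids the forbidden words of X up to length N, so that its words
    of that length come from X itself. *)
Lemma image_cover_language n N z i l : sft_cover X n = sft_cover X N ->
  (pi @` sft_cover X n) z -> (l + 2 * r <= N)%N -> language Y (subword z i l).
Proof.
move=> nN [x + <-] lN; rewrite nN => /sft_coverP h.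
by apply: language_image; exact: h.
Qed.

Lemma shiftz_period (C : finType) (z : fullshift C) (p : nat) k :
  shiftz p%:Z z = z -> shiftz (p%:Z * k) z = z.
Proof.
move=> zp; have zn n : shiftz (p%:Z * n%:Z) z = z.
  elim: n => [|n IH]; first by rewrite mulr0 shiftz0.
  by rewrite intS mulrDr mulr1 -shiftzD IH.
case: k => n; first exact: zn.
rewrite -[in LHS](zn n.+1) shiftzD -mulrDr.
have -> : Negz n + n.+1%:Z = 0 by lia.
by rewrite mulr0 shiftz0.
Qed.

(** Lift the word of z on [0, L) to a point x of X. Among the windows of x of length W
    at the positions j p - r, for j at most K, two coincide; repeat the stretch between
    them for ever. The result x' looks like x through windows of length W, so it lies
    in the cover, and its image has the symbols of z over one period. *)
Lemma periodic_lift n W K p L (z : fullshift B) :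
  (0 < p)%N -> shiftz p%:Z z = z -> (n <= W)%N -> (2 * r <= W)%N ->
  (#|A| ^ W <= K)%N -> (K * p + W <= L + 2 * r)%N ->
  language Y (subword z 0 L) -> (pi @` sft_cover X n) z.
Proof.
move=> p0 zp nW rW KA KL /(language_lift 0)[x Xx /subword_eqP xz].
pose f (j : 'I_K.+1) : {ffun 'I_W -> A} := [ffun s : 'I_W => x ((j * p)%N%:Z - r%:Z + s%:Z)].
have /injectivePn[j1 [j2 j12 fj12]] : ~~ injectiveb f.
  apply/negP => /injectiveP/leq_card; rewrite card_ffun !card_ord.
  by rewrite leqNgt ltnS KA.
wlog jj : j1 j2 j12 fj12 / (j1 < j2)%N => [wl|].
  have /orP[] : (j1 < j2)%N || (j2 < j1)%N by rewrite -neq_ltn.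
    exact: wl.
  by apply: wl => //; rewrite eq_sym.
pose q := ((j2 - j1) * p)%N.
have [i0 i0E] : exists i : int, i = (j1 * p)%N%:Z - r%:Z by eexists.
have q0 : (0 < q)%N by rewrite muln_gt0 subn_gt0 jj.
have xq s : (s < W)%N -> x (i0 + q%:Z + s%:Z) = x (i0 + s%:Z).
  move=> sW; have := congr1 (fun w : {ffun 'I_W -> A} => w (Ordinal sW)) fj12.
  rewrite !ffunE /= -i0E => ->; congr x; rewrite i0E /q mulnBl.
  have : (j1 * p <= j2 * p)%N by rewrite leq_mul2r (ltnW jj) orbT.
  lia.
(* x' repeats the stretch of x on [i0, i0 + q). *)
pose x' : fullshift A := fun i => x (i0 + ((i - i0) %% q%:Z)%Z).
have q0' : q%:Z != 0 by lia.
have x'q i : x' (i + q%:Z) = x' i.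
  by rewrite /x'; congr (x (i0 + _)); rewrite addrAC modzDr.
have x'x u : (u < q + W)%N -> x' (i0 + u%:Z) = x (i0 + u%:Z).
  elim/ltn_ind: u => u IH uqW; have [uq|qu] := ltnP u q.
    rewrite /x'; have -> : i0 + u%:Z - i0 = u%:Z by lia.
    by rewrite modz_small//; lia.
  have -> : i0 + u%:Z = i0 + (u - q)%N%:Z + q%:Z by lia.
  rewrite x'q IH; [|lia|lia].
  by rewrite -(xq (u - q)%N); [congr x; lia|lia].
have x'per : shiftz q%:Z x' = x' by apply/funext => i; rewrite /shiftz x'q.
have red (i : int) : exists t k, [/\ (t < q)%N & i = i0 + t%:Z + q%:Z * k].
  exists `|((i - i0) %% q%:Z)%Z|%N, ((i - i0) %/ q%:Z)%Z.
  have m0 : (0 <= (i - i0) %% q%:Z)%Z by exact: modz_ge0.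
  have mq : ((i - i0) %% q%:Z < q%:Z)%Z by apply: ltz_pmod; lia.
  split; first lia.
  have := divz_eq (i - i0) q%:Z; rewrite gez0_abs//; lia.
exists x'.
  apply/sft_coverP => i l ln; have [t [k [tq ->]]] := red i.
  rewrite -subword_shift shiftz_period//.
  have -> : subword x' (i0 + t%:Z) l = subword x (i0 + t%:Z) l.
    by apply/subword_eqP => s sl; rewrite -!addrA -!PoszD x'x//; lia.
  by exists x => //; exact: occurs_subword.
apply/funext => i; have [t [k [tq iE]]] := red (i - r%:Z).
pose j : int := (j1 * p + t)%N%:Z.
have {iE}-> : i = j + q%:Z * k by rewrite /j; lia.
have -> : pi x' (j + q%:Z * k) = pi x' j.
  rewrite -[LHS]/(shiftz (q%:Z * k) (pi x') j) -block_map_shift.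
  by rewrite shiftz_period.
have -> : z (j + q%:Z * k) = z j.
  rewrite -[LHS]/(shiftz (q%:Z * k) z j) (_ : q%:Z * k = p%:Z * ((j2 - j1)%N%:Z * k)).
    by rewrite shiftz_period.
  by rewrite /q PoszM -mulrA mulrCA.
have -> : pi x' j = pi x j.
  congr Phi; apply/subword_eqP => s sr.
  have -> : j - r%:Z + s%:Z = i0 + (t + s)%N%:Z by rewrite /j i0E; lia.
  apply: x'x; lia.
have j2K : (j2 * p <= K * p)%N by rewrite leq_mul2r -ltnS ltn_ord orbT.
have jL : (j1 * p + t < L)%N by move: tq; rewrite /q mulnBl; lia.
by have := xz _ jL; rewrite !add0r.
Qed.

Section Periodic.
Variables (n N a m R1 : nat).
Hypothesis nN : sft_cover X n = sft_cover X N.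
Hypothesis NE : (N = 2 * m + a * m ^ (2 * m).+1)%N.
Hypotheses (nm : (n <= m)%N) (rm : (2 * r <= m)%N) (Rm : ((4 * R1).+1 <= m)%N).
Hypothesis Am : (#|A| <= m)%N.
Local Notation Z := (pi @` sft_cover X n).

Variables (Ga Th : seq B -> B) (g : points Y -> points Y).
Hypothesis gE : forall y : points Y, val (g y) = block_map R1 Ga (val y).
Hypothesis hE : forall y : points Y, block_map R1 Th (val (g y)) = val y.

Lemma automorphism_language z i l : language Y (subword z (i - R1%:Z) (l + 2 * R1)) ->
  language Y (subword (block_map R1 Ga z) i l).
Proof.
move=> /languageE/(_ (i - R1%:Z))[y Yy]; rewrite size_subword => e.
rewrite -(@block_map_local B B R1 Ga y z i i l e).
have <- := gE (mkpoint Yy).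
by exists (val (g (mkpoint Yy))); [exact: pointsP|exact: occurs_subword].
Qed.

(** As far as words of length N - 2r - 2 R1 can tell, the codes of g and of its inverse
    act on z as on a point of Y. The image of z has the period of z and its long words
    belong to Y, so that periodic_lift, with windows of length m, brings it back into
    the image of the cover. *)
Lemma automorphism_periodic z p : (1 <= p <= a)%N -> Z z -> shiftz p%:Z z = z ->
  [/\ Z (block_map R1 Ga z), shiftz p%:Z (block_map R1 Ga z) = block_map R1 Ga z &
      block_map R1 Th (block_map R1 Ga z) = z].
Proof.
move=> /andP[p1 pa] Zz zp.
have bp : shiftz p%:Z (block_map R1 Ga z) = block_map R1 Ga z.
  by rewrite -block_map_shift zp.
have m0 : (0 < m)%N by apply: leq_trans Rm.
split=> //.
  pose L := (N - 2 * r - 2 * R1)%N.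
  have pw : (m ^ m * p <= a * m ^ (2 * m).+1)%N.
    by rewrite mulnC leq_mul// leq_pexp2l//; lia.
  apply: (@periodic_lift n m (m ^ m) p L) => //; [by rewrite leq_exp2r| |].
    by rewrite /L; lia.
  apply: automorphism_language.
  have LN : (L + 2 * R1 + 2 * r <= N)%N by rewrite /L; lia.
  exact: (image_cover_language _ nN Zz LN).
apply/funext => t.
have wY : language Y (subword z (t - (2 * R1)%N%:Z) (4 * R1).+1).
  have RN : ((4 * R1).+1 + 2 * r <= N)%N by lia.
  exact: (image_cover_language _ nN Zz RN).
move: wY => /languageE/(_ (t - (2 * R1)%N%:Z))[y Yy]; rewrite size_subword => e.
have <- : y t = z t.
  have /subword_eqP/(_ (2 * R1)%N) := e.
  by rewrite subrK; apply; lia.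
have := hE (mkpoint Yy); rewrite gE /= => /(congr1 (fun u : fullshift B => u t)) <-.
congr Th; apply/esym.
apply: block_map_local.
have -> : t - R1%:Z - R1%:Z = t - (2 * R1)%N%:Z by lia.
have -> : ((2 * R1).+1 + 2 * R1)%N = (4 * R1).+1 by lia.
exact: e.
Qed.
End Periodic.
End Lifting.

(** * Recoding and the approximation time *)

Lemma subshift_ext (A : finType) (X Y : subshift A) : carrier X = carrier Y -> X = Y.
Proof.
case: X Y => C nC cC iC [D nD cD iD] /= CD; rewrite -{}CD in nD cD iD *.
by congr Subshift; exact: Prop_irrelevance.
Qed.

Lemma infinite_nat_ge (S : set nat) n : infinite_set S -> exists2 s, S s & (n <= s)%N.
Proof.
move=> infS; apply: contrapT => h; apply: infS.
apply: sub_finite_set (finite_II n) => s Ss /=.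
by rewrite ltnNge; apply/negP => ns; apply: h; exists s.
Qed.

Section Recode.
Variables (A B : finType) (X : subshift A) (n m r : nat) (Phi : seq A -> B).
Variables (eA : A -> 'I_m) (dA : 'I_m -> A) (eB : B -> 'I_m).
Hypothesis (eAK : cancel eA dA).
Hypotheses (m0 : (0 < m)%N) (nm : (n <= m)%N) (rm : (r <= m)%N).

Let a0 := dA (Ordinal m0).

(** A map of letters, as a block code of radius 0. *)
Definition letterwise (e : A -> 'I_m) (w : seq A) : 'I_m := e (head a0 w).

Lemma block_map_letterwise e x : block_map 0 (letterwise e) x = (fun i => e (x i)).
Proof.
by apply/funext => t; rewrite /block_map /letterwise muln0 /= subr0 addr0.
Qed.

Definition recoded_sft : subshift 'I_m :=
  image_subshift 0 (letterwise eA) (cover_subshift X n).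

Definition recoded_sofic : subshift 'I_m :=
  image_subshift r (eB \o Phi) (cover_subshift X n).

Lemma subword_map (C D : finType) (f : C -> D) (x : fullshift C) i l :
  subword (fun j => f (x j) : D) i l = map f (subword x i l).
Proof. by rewrite /subword /mkseq -map_comp. Qed.

(** Forbid the words of length at most m that do not come from the cover: those of
    length 1 force all letters to come from A, and those of length at most n force
    the decoded point into the cover. *)
Lemma recoded_sft_class : sft_class m recoded_sft.
Proof.
exists [set w | (size w <= m)%N /\
  ~ exists2 v, language (cover_subshift X n) v & w = map eA v].
split=> [w []//|]; apply/seteqP; split.
  move=> _ [x Xx <-] w [_ nw] [i wi]; apply: nw.
  exists (subword x i (size w)); first by exists x => //; exact: occurs_subword.
  by rewrite -subword_map -[LHS]wi block_map_letterwise.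
move=> xh h; have lg i l : (l <= m)%N ->
    exists2 v, language (cover_subshift X n) v & subword xh i l = map eA v.
  move=> lm; apply: contrapT => nv.
  apply: (h (subword xh i l)); last exact: occurs_subword.
  by split; first by rewrite size_subword.
pose x : fullshift A := fun i => dA (xh i).
have xhE : xh = (fun i => eA (x i)).
  apply/funext => i; have [v _] := lg i 1%N m0.
  case: v => //= a v; rewrite /subword /mkseq /= addr0 => -[xa _].
  by rewrite /x xa eAK.
exists x; last by rewrite block_map_letterwise xhE.
apply/sft_coverP => i l ln.
have [v [y Xy [j yv]] e] := lg i l (leq_trans ln nm).
have -> : subword x i l = v.
  by apply: (inj_map (can_inj eAK)); rewrite -subword_map -xhE.
have sl : size v = l by rewrite -(size_map eA) -e size_subword.
by rewrite -yv; move: Xy => /sft_coverP; apply; rewrite sl.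
Qed.

Lemma sft_class_is_sft a f (Z : subshift 'I_a) : sft_class f Z -> is_sft Z.
Proof.
case=> F [Ff ZF]; exists F; split=> //.
apply: sub_finite_set (finite_short_words _ f); exact: Ff.
Qed.

Lemma recoded_sofic_class : sofic_class m m recoded_sofic.
Proof.
pose Psi (w : seq 'I_m) := eB (Phi (map dA w)).
have [Psi' PsiE] := block_map_widen Psi rm.
have key x : block_map m Psi' (block_map 0 (letterwise eA) x) = block_map r (eB \o Phi) x.
  rewrite -PsiE block_map_letterwise; apply/funext => t.
  by rewrite /block_map /Psi subword_map -map_comp map_id_in// => a _ /=; exact: eAK.
have [phi [fphi phiE]] : exists phi : points recoded_sft -> points recoded_sofic,
    factor_map phi /\ forall x : points recoded_sft, val (phi x) = block_map m Psi' (val x).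
  apply: block_factor; apply/seteqP; split=> [_ [_ [x Xx <-] <-]|_ [x Xx <-]].
    by exists x.
  by exists (block_map 0 (letterwise eA) x); [exists x|exact: key].
split.
  exists 'I_m, recoded_sft; split; last by exists phi.
  exact: sft_class_is_sft recoded_sft_class.
exists recoded_sft, phi; split=> //; first exact: recoded_sft_class.
by exists Psi' => x t; rewrite phiE.
Qed.
End Recode.

Section ApproxTime.
Variables (R : realType) (S : set nat).
Variable mu : forall (a : nat) (Y : subshift 'I_a), probability (borel (points Y)) R.
Hypothesis S_inf : infinite_set S.
Variables a f r : nat.
Hypothesis lim_mu : forall Y : subshift 'I_a, sofic_class f r Y ->
  per_weak_limit S (mu Y).

(** The finitely many data that determine a member of the class: the forbidden words
    of an SFT and the table of a block code. *)
Definition code := ({set {n : 'I_f.+1 & n.-tuple 'I_a}} *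
  {ffun {ffun 'I_(2 * r).+1 -> 'I_a} -> 'I_a})%type.

Definition decode (c : code) : set (fullshift 'I_a) :=
  [set y | exists2 x : fullshift 'I_a,
     avoid [set w | exists2 u, u \in c.1 & w = tval (tagged u)] x &
     forall t, y t = c.2 [ffun i : 'I_(2 * r).+1 => x (t - r%:Z + i%:Z)]].

(** Two members of the class with the same code have the same points, so the class is
    finite. *)
Lemma sofic_decode (Y : subshift 'I_a) : sofic_class f r Y ->
  exists c, carrier Y = decode c.
Proof.
case=> _ [X [phi [[F [Ff XF]] [_ phis _] [Phi PhiE]]]].
pose F' := [set u : {n : 'I_f.+1 & n.-tuple 'I_a} | `[<F (tval (tagged u))>]]%SET.
pose Phi' : {ffun {ffun 'I_(2 * r).+1 -> 'I_a} -> 'I_a} :=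
  [ffun v : {ffun 'I_(2 * r).+1 -> 'I_a} => Phi [seq v i | i <- enum 'I_(2 * r).+1]].
have F'E : [set w | exists2 u, u \in F' & w = tval (tagged u)] = F.
  apply/seteqP; split=> [_ [u + ->]|w Fw]; first by rewrite inE => /asboolP.
  have wf : (size w < f.+1)%N by exact: Ff.
  exists (existT (fun n : 'I_f.+1 => n.-tuple 'I_a) (Ordinal wf) (in_tuple w)) => //.
  by rewrite inE; apply/asboolP.
have Phi'E (x : fullshift 'I_a) t :
    Phi' [ffun i : 'I_(2 * r).+1 => x (t - r%:Z + i%:Z)] =
    Phi (subword x (t - r%:Z) (2 * r).+1).
  rewrite ffunE; congr Phi; rewrite /subword /mkseq -val_enum_ord -map_comp.
  by apply: eq_map => i; rewrite ffunE.
exists (F', Phi'); apply/seteqP; split=> [y Yy|y [x + xy]].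
  have [x _ xy] := phis (mkpoint Yy) I.
  exists (val x); first by rewrite /= F'E -XF; exact: pointsP.
  by move=> t; rewrite /= Phi'E -PhiE xy.
rewrite /= F'E -XF => Xx.
have -> : y = val (phi (mkpoint Xx)).
  by apply/funext => t; rewrite PhiE xy /= Phi'E.
exact: pointsP.
Qed.

Lemma cylinder_continuous (Y : subshift 'I_a) w : continuous (\1_(cylinder Y w) : points Y -> R).
Proof.
move=> x; apply: cvg_near_cst; first exact: (@nbhs_filter (points Y) x).
suff h : nbhs x [set y : points Y | \1_(cylinder Y w) y = \1_(cylinder Y w) x :> R] by [].
apply/points_nbhs; exists (size w).+1 => y xy /=.
have e : subword (val x) 1 (size w) = subword (val y) 1 (size w).
  by apply/subword_eqP => k kw; apply: xy; lia.
rewrite !indicE; congr (nat_of_bool _)%:R.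
by apply/idP/idP; rewrite !inE /cylinder /= e.
Qed.

Lemma cylinder_borel (Y : subshift 'I_a) w : measurable (cylinder Y w : set (borel (points Y))).
Proof.
apply: (@plocal_measurable _ _ (size w).+1) => x y xy; rewrite /cylinder /= => xw.
rewrite -[RHS]xw; apply/subword_eqP => k kw; apply: esym; apply: xy.
by apply: leq_trans (leqW kw); lia.
Qed.

Lemma approx_one (Y : subshift 'I_a) w e : sofic_class f r Y -> 0 < e ->
  exists s0, forall s, S s -> (s0 <= s)%N ->
    `| fine (mu Y (cylinder Y w)) - per_mean s \1_(cylinder Y w) | < e.
Proof.
move=> sY e0; have := lim_mu sY (@cylinder_continuous Y w).
rewrite /Rintegral integral_indic//; last exact: cylinder_borel.
rewrite setIT => /cvgrPdist_lt/(_ e e0)[s0 _ hs].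
by exists s0 => s Ss s0s; exact: hs s0s Ss.
Qed.

(** Convergence holds for each of the finitely many shifts of the class and each of the
    finitely many words of length at most m, hence uniformly from some time on. Thus the
    set whose least element is the approximation time is not empty. *)
Lemma approx_timeP k m : (0 < k)%N ->
  S (approx_time S mu a f r k m) /\
  forall Y : subshift 'I_a, sofic_class f r Y ->
    forall w, language Y w -> (1 <= size w <= m)%N ->
    `| fine (mu Y (cylinder Y w))
       - per_mean (approx_time S mu a f r k m) \1_(cylinder Y w) | < k%:R^-1.
Proof.
move=> k0; have k1 : 0 < k%:R^-1 :> R by rewrite invr_gt0 ltr0n.
have h (cw : code * {n : 'I_m.+1 & n.-tuple 'I_a}) : exists s0,
    forall Y : subshift 'I_a, sofic_class f r Y -> carrier Y = decode cw.1 ->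
    forall s, S s -> (s0 <= s)%N ->
    `| fine (mu Y (cylinder Y (tval (tagged cw.2))))
       - per_mean s \1_(cylinder Y (tval (tagged cw.2))) | < k%:R^-1.
  have [[Y0 sY0 Y0c]|nY] := pselect (exists2 Y : subshift 'I_a,
      sofic_class f r Y & carrier Y = decode cw.1).
    have [s0 hs] := approx_one (tval (tagged cw.2)) sY0 k1; exists s0 => Y sY Yc.
    by rewrite (@subshift_ext _ Y Y0) ?Y0c.
  by exists 0%N => Y sY Yc; case: nY; exists Y.
have [s0 hs] := choice h.
have [s Ss smax] := infinite_nat_ge (\max_cw s0 cw)%N S_inf.
rewrite /approx_time; set P := (P in least P).
have Ps : P s.
  split=> // Y sY w _ /andP[_ wm] t St st; have [c Yc] := sofic_decode sY.
  have wm' : (size w < m.+1)%N by [].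
  apply: (hs (c, existT (fun n : 'I_m.+1 => n.-tuple 'I_a) (Ordinal wm') (in_tuple w))) => //.
  by apply: leq_trans st; apply: leq_trans smax; exact: leq_bigmax.
have [[SA hA] _] := leastP Ps.
by split=> // Y sY w wL wm; exact: hA.
Qed.
End ApproxTime.

(** * The periodic means of a stable cover *)

Section EntropyBound.
Variables (A : finType) (X : subshift A) (R : realType).
Variable mu : probability (borel (points X)) R.
Hypothesis muS : invariant_under mu (@sigma A X).

Lemma sigma_measurable (E : set (borel (points X))) :
  measurable E -> measurable (@sigma A X @^-1` E : set (borel (points X))).
Proof. by apply: continuous_borel; exact: sigma_continuous. Qed.

Lemma join_entropyE k (P : points X -> 'I_k) n :
  join_entropy mu (@sigma A X) P n =
  Hlaw mu (@itinerary _ (borel (points X)) (@sigma A X) _ P n).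
Proof.
rewrite /join_entropy /Hlaw /entropy; congr (- _); apply: eq_bigr => w _ /=.
suff -> : [set x | forall i : 'I_n, P (iter i (@sigma A X) x) = w i] =
  @itinerary _ (borel (points X)) (@sigma A X) _ P n @^-1` [set w] by [].
apply/seteqP; split=> x /=; first by move=> h; apply/ffunP => i; rewrite ffunE.
by move=> <- i; rewrite ffunE.
Qed.

Lemma coordinate_mlabel (W : finType) (G : points X -> W) :
  (forall x y : points X, val x 0 = val y 0 -> G x = G y) ->
  mlabel (G : borel (points X) -> W).
Proof.
move=> GG w; apply: (@plocal_measurable _ _ 0) => x y xy /= <-.
by apply/esym/GG/xy.
Qed.

Lemma measure_entropy_le (W : finType) (G : points X -> W) N : (0 < N)%N ->
  (forall x y : points X, G x = G y <-> val x 0 = val y 0) ->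
  (measure_entropy mu (@sigma A X) <=
   (Hlaw mu (@itinerary _ (borel (points X)) (@sigma A X) _ G N) / N%:R)%:E)%E.
Proof.
move=> N0 GG; apply: ge_ereal_sup => _ [k [P [mP ->]]]; rewrite lee_fin.
under eq_fun do rewrite join_entropyE.
apply: Hlaw_generator => //.
- exact: sigma_measurable.
- by apply: coordinate_mlabel => x y /GG.
- exact: coordinate_generates.
Qed.
End EntropyBound.

Section PerMean.
Variables (A : finType) (X : subshift A) (R : realType).

(** A point fixed by the q-th power of the shift is determined by q symbols. *)
Lemma finite_per_le s : finite_set (per_le X s).
Proof.
pose D q := [set x : points X | iter q (@sigma A X) x = x].
have finD q : (0 < q)%N -> finite_set (D q).
  move=> q0; pose word (x : points X) : {ffun 'I_q -> A} := [ffun i : 'I_q => val x i%:Z].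
  pose g w := xget point [set x | D q x /\ word x = w].
  apply: (@sub_finite_set _ _ (range g)); last exact/finite_image/finite_finset.
  move=> x Dx; exists (word x) => //; rewrite /g; case: xgetP; last by move/(_ x) => -[].
  move=> _ -> [Dy yx]; apply: val_points_inj; apply/funext => i.
  have per (y : points X) : D q y -> val y i = val y (i %% q%:Z)%Z.
    move=> Dy'; have yq : shiftz q%:Z (val y) = val y by rewrite -val_sigma_iter Dy'.
    rewrite -[in LHS](shiftz_period (- (i %/ q%:Z)%Z) yq) /shiftz.
    by congr (val y _); rewrite mulrN mulrC {1}(divz_eq i q%:Z) addrAC subrr add0r.
  rewrite !per//.
  have h1 : (i %% q%:Z)%Z < q%:Z by apply: ltz_pmod; lia.
  have h2 : 0 <= (i %% q%:Z)%Z by apply: modz_ge0; lia.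
  have iq : (`|(i %% q%:Z)%Z|%N < q)%N by lia.
  have := congr1 (fun w : {ffun 'I_q -> A} => w (Ordinal iq)) yx; rewrite !ffunE /=.
  by rewrite gez0_abs.
have -> : per_le X s = \bigcup_(q in [set q | (1 <= q <= s)%N]) D q.
  by apply/seteqP; split=> x [q ? ?]; exists q.
apply: bigcup_finite => [|q /= /andP[q0 _]]; last exact: finD.
by apply: sub_finite_set (finite_II s.+1) => q /= /andP[_].
Qed.

Lemma per_mean_sum (V : finType) (D : pred V) (F : V -> points X -> R) s :
  per_mean s (fun z => \sum_(v | D v) F v z) = \sum_(v | D v) per_mean s (F v).
Proof.
rewrite /per_mean -mulr_suml; congr (_ / _).
rewrite fsbig_finite; last exact: finite_per_le.
rewrite exchange_big/=; apply: eq_bigr => v _.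
by rewrite fsbig_finite//; exact: finite_per_le.
Qed.

Lemma per_mean_bij s (g : points X -> points X) (f f' : points X -> R) :
  set_bij (per_le X s) (per_le X s) g ->
  (forall z, per_le X s z -> f' z = f (g z)) -> per_mean s f' = per_mean s f.
Proof.
move=> bg fg; rewrite /per_mean; congr (_ / _).
rewrite (@reindex_fsbig _ _ _ _ _ g (per_le X s) (per_le X s) f bg).
by apply: eq_fsbigr => z; rewrite inE; exact: fg.
Qed.

Lemma per_mean0 s : per_mean s (fun _ : points X => 0 : R) = 0.
Proof. by rewrite /per_mean fsbig1// mul0r. Qed.

Lemma sigma_per_bij s t : set_bij (per_le X s) (per_le X s) (@pshift A X t).
Proof.
have per u x : per_le X s x -> per_le X s (pshift u x).
  case=> q qs xq; exists q => //; rewrite sigma_iter pshiftD addrC -pshiftD.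
  by rewrite -sigma_iter xq.
split.
- by move=> x; exact: per.
- move=> x y _ _ /(congr1 (pshift (- t))); rewrite !pshiftD addNr.
  by rewrite !pshift0.
- move=> x Px; exists (pshift (- t) x); first exact: per.
  by rewrite pshiftD addrN pshift0.
Qed.
End PerMean.

Definition flocal (A : finType) k (D : set (fullshift A)) :=
  forall x y, agree k x y -> D x -> D y.

Section FiniteStage.
Variables (R : realType) (S : set nat).
Variable mu : forall (a : nat) (Y : subshift 'I_a), probability (borel (points Y)) R.
Hypothesis S_pos : forall s, S s -> (0 < s)%N.
Hypothesis S_inf : infinite_set S.
Hypothesis mu_spec : forall a f r : nat, (0 < a)%N -> (0 < f)%N -> (0 < r)%N ->
  forall Y : subshift 'I_a, sofic_class f r Y ->
  [/\ per_weak_limit S (mu Y), characteristic (mu Y) & max_entropy_measure (mu Y)].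
Variables (A B : finType) (X : subshift A) (Y : subshift B).
Variables (r : nat) (Phi : seq A -> B).
Hypothesis XY : block_map r Phi @` carrier X = carrier Y.
Local Notation pi := (block_map r Phi).

Lemma next_timeP n : S (next_time S n) /\ (n < next_time S n)%N.
Proof.
have [s Ss ns] := infinite_nat_ge n.+1 S_inf.
have Ps : [set s | S s /\ ~~ (1 <= s <= n)%N] s.
  by split=> //; rewrite negb_and -!ltnNge ns orbT.
have [[SA hA] _] := leastP Ps.
split=> //; move: hA; rewrite negb_and -!ltnNge ltnS leqn0 => /orP[/eqP e|//].
by have := S_pos SA; rewrite e.
Qed.

Lemma finite_recode (C : finType) (c0 : C) m : (#|C| <= m)%N ->
  exists (e : C -> 'I_m) (d : 'I_m -> C), cancel e d.
Proof.
move=> Cm; pose e c : 'I_m := widen_ord Cm (enum_rank c).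
have ei : injective e.
  by move=> c c' /(congr1 val) /= /val_inj /enum_rank_inj.
exists e, (fun i => odflt c0 [pick c | e c == i]) => c.
by case: pickP => [c' /eqP/ei//|/(_ c)]; rewrite eqxx.
Qed.

Variable n : nat.
Let m := next_time S n.
Let a := approx_time S mu m m m m m.
Hypothesis stable : sft_cover X n = sft_cover X (n + omega S mu n).
Hypotheses (Am : (#|A| <= m)%N) (Bm : (#|B| <= m)%N) (rm : (2 * r <= m)%N).
Local Notation Z := (pi @` sft_cover X n).

(** What the limit retains of the measure of maximal entropy attached to X_n,
    transported to the full shift over B: mass, additivity, support in the image of
    X_n, almost invariance under the codes of the automorphisms of Y whose radius is
    small with respect to m, and an entropy of N symbols at least N times that of Y. *)
Definition stage (M : set (fullshift B) -> R) := [/\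
  forall D, 0 <= M D,
  M setT = 1,
  forall k C D, flocal k C -> flocal k D -> C `&` D = set0 ->
    M (C `|` D) = M C + M D,
  forall C D, (forall z, Z z -> C z <-> D z) -> M C = M D &
  (forall R1 Ga Th (g h : points Y -> points Y), ((4 * R1).+1 <= m)%N ->
     (forall y : points Y, val (g y) = block_map R1 Ga (val y)) ->
     (forall y : points Y, val (h y) = block_map R1 Th (val y)) ->
     cancel g h -> cancel h g ->
   forall k D, flocal k D -> ((2 * (k + R1)).+1 <= m)%N ->
     `|M (block_map R1 Ga @^-1` D) - M D| <= (2 * #|B| ^ (2 * (k + R1)).+1)%:R / m%:R) /\
  forall N, (0 < N)%N -> hlang Y R <=
    entropy (fun w : {ffun 'I_N -> B} => M [set x | forall i : 'I_N, x i%:Z = w i]) / N%:R].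

(** M is the measure attached to the recoded image of X_n, and K the mean over its points
    of period at most a. By the choice of a, they differ by at most 1 / m on each cylinder
    of length at most m. K is invariant under the code of g, which permutes these periodic
    points. For the entropy, the image of X_n has at least the words of Y, and M has
    maximal entropy. *)
Lemma stage_exists : exists M, stage M.
Proof.
have [Sm nm] := next_timeP n; rewrite -/m in Sm nm.
have m0 : (0 < m)%N by exact: S_pos.
pose a0 : A := val (point : points X) 0; pose b0 : B := val (point : points Y) 0.
have [eA [dA eAK]] := finite_recode a0 Am.
have [eB [dB eBK]] := finite_recode b0 Bm.
have rm' : (r <= m)%N by lia.
pose Yh := recoded_sofic X n r Phi eB.
have sYh : sofic_class m m Yh := recoded_sofic_class X Phi eB eAK m0 (ltnW nm) rm'.
have [_ _ [muS maxent]] := mu_spec m0 m0 m0 sYh.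
have lim_mu (V : subshift 'I_m) : sofic_class m m V -> per_weak_limit S (mu V).
  by move=> sV; have [] := mu_spec m0 m0 m0 sV.
have [Sa ha] : S a /\ _ := approx_timeP S_inf lim_mu m m0.
have {}ha := ha _ sYh; rewrite -/a in ha.
have a_pos : (0 < a)%N by exact: S_pos.
pose N := (n + omega S mu n)%N.
have NE : N = (2 * m + a * m ^ (2 * m).+1)%N by rewrite /N /omega -/m -/a; lia.
pose dec (y : points Yh) : fullshift B := fun i => dB (val y i).
have decE (y : points Yh) : val y = (fun i => eB (dec y i)).
  have [x Xx xy] := pointsP y; rewrite /dec -xy; apply/funext => i.
  by rewrite /block_map /= eBK.
have decZ (y : points Yh) : Z (dec y).
  have [x Xx xy] := pointsP y; exists x => //.
  by rewrite /dec -xy; apply/funext => i; rewrite /block_map /= eBK.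
have encZ z : Z z -> exists y : points Yh, dec y = z.
  move=> [x Xx <-]; have Yx : carrier Yh (block_map r (eB \o Phi) x) by exists x.
  by exists (mkpoint Yx); apply/funext => i; rewrite /dec /block_map /= eBK.
have dec_inj : injective dec.
  by move=> y y' e; apply: val_points_inj; rewrite !decE e.
have dec_shift t (y : points Yh) : dec (pshift t y) = shiftz t (dec y) by [].
have dec_local k D : flocal k D -> plocal k (dec @^-1` D).
  by move=> h x y xy; apply: h => i ik; rewrite /dec (xy i ik).
pose M D := fine (mu Yh (dec @^-1` D)).
pose K D : R := per_mean a \1_(dec @^-1` D).
have muSh t D k : flocal k D -> M (shiftz t%:Z @^-1` D) = M D.
  move=> lD; rewrite /M -[in RHS](mu_iter (@sigma_measurable _ Yh) muS t).
    congr (fine (mu Yh _)); apply/seteqP; split=> y /=;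
      by rewrite sigma_iter dec_shift.
  exact: plocal_measurable (dec_local _ _ lD).
have KSh t D : K (shiftz t%:Z @^-1` D) = K D.
  apply: (per_mean_bij (sigma_per_bij Yh a t%:Z)) => z _.
  by rewrite !indicE.
have B0 : (0 < #|B|)%N by apply/card_gt0P; exists b0.
(* The approximation is known for cylinders at the positions 1, 2, ..., and both M
   and K are invariant under the shift; move D there and cut it into cylinders. *)
have close k D : flocal k D -> ((2 * k).+1 <= m)%N ->
    `|M D - K D| <= (#|B| ^ (2 * k).+1)%:R / m%:R.
  move=> lD km; set L := (2 * k).+1 in km *.
  pose D1 := shiftz k.+1%:Z @^-1` D.
  rewrite -(muSh k.+1 D k lD) -(KSh k.+1 D) -/D1.
  pose lab (y : points Yh) : {ffun 'I_L -> B} := [ffun i : 'I_L => dec y (1 + i%:Z)].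
  pose P (v : {ffun 'I_L -> B}) :=
    `[< exists2 x, D1 x & forall i : 'I_L, x (1 + i%:Z) = v i >].
  have preE : dec @^-1` D1 = lab @^-1` [set v | P v].
    apply/seteqP; split=> y /=.
      by move=> Dy; apply/asboolP; exists (dec y) => // i; rewrite ffunE.
    move=> /asboolP[x Dx xv]; apply: lD Dx => j jk; rewrite /shiftz.
    have jL : (`|(j + k%:Z)%R|%N < L)%N by rewrite /L; lia.
    have := xv (Ordinal jL); rewrite ffunE /=.
    by have -> : 1 + `|(j + k%:Z)%R|%N%:Z = j + k.+1%:Z by lia.
  pose wd (v : {ffun 'I_L -> B}) := [seq eB (v i) | i <- enum 'I_L].
  have szw v : size (wd v) = L by rewrite size_map size_enum_ord.
  have cylE v : lab @^-1` [set v] = cylinder Yh (wd v).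
    have e (y : points Yh) : subword (val y) 1 L = wd (lab y).
      rewrite /subword /mkseq -val_enum_ord -map_comp.
      by apply: eq_map => i; rewrite decE ffunE.
    apply/seteqP; split=> y; rewrite /cylinder /= szw e; first by move=> <-.
    move=> /eq_in_map h; apply/ffunP => i.
    by apply: (can_inj eBK); apply: h; rewrite mem_enum.
  have mlab : mlabel (lab : borel (points Yh) -> _).
    by move=> v; rewrite cylE; exact: cylinder_borel.
  have ME : M D1 = \sum_(v | P v) law (mu Yh) lab v by rewrite /M preE law_pre.
  have KE : K D1 = \sum_(v | P v) per_mean a \1_(lab @^-1` [set v]).
    rewrite -per_mean_sum /K preE; congr (per_mean a _); apply/funext => y.
    rewrite indicE; have [Py|nPy] := boolP (P (lab y)).
      rewrite (bigD1 (lab y))//= big1 ?addr0 => [|v /andP[_ vy]].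
        by rewrite !indicE !mem_set.
      by rewrite indicE memNset//= => e; rewrite e eqxx in vy.
    rewrite memNset; last exact/negP.
    rewrite big1// => v Pv; rewrite indicE memNset//= => e.
    by rewrite -e (negbTE nPy) in Pv.
  rewrite ME KE -sumrB; apply: (le_trans (ler_norm_sum _ _ _)).
  apply: (@le_trans _ _ (\sum_(v | P v) (m%:R^-1 : R))).
    apply: ler_sum => v _; rewrite /law cylE.
    have [wL|nL] := pselect (language Yh (wd v)).
      by apply/ltW/ha; rewrite ?szw.
    have -> : cylinder Yh (wd v) = set0.
      apply/seteqP; split=> // y yw; apply: nL; exists (val y); first exact: pointsP.
      by exists 1.
    rewrite measure0 indic0 per_mean0 subrr normr0.
    by rewrite invr_ge0.
  rewrite sumr_const -[leLHS]mulr_natl ler_wpM2r ?invr_ge0// ler_nat.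
  by apply: (leq_trans (max_card _)); rewrite card_ffun card_ord.
exists M; split.
- by move=> D; exact: fine_mu_ge0.
- by rewrite /M preimage_setT probability_setT.
- move=> k C D lC lD CD; rewrite /M preimage_setU.
  have mC := plocal_measurable (dec_local _ _ lC).
  have mD := plocal_measurable (dec_local _ _ lD).
  have dCD : dec @^-1` C `&` dec @^-1` D = set0 by rewrite -preimage_setI CD preimage_set0.
  have e := measureU (mu Yh) mC mD dCD.
  apply: etrans (congr1 fine e) _.
  by apply: fineD; apply: fin_num_measure.
- move=> C D CD; rewrite /M; congr (fine (mu Yh _)).
  by apply/seteqP; split=> y /=; apply CD.
- split=> [R1 Ga Th g h Rm gE hE gh hg k D lD km|N' N0].
    have lGD : flocal (k + R1) (block_map R1 Ga @^-1` D).
      by move=> x y xy; apply: lD; exact: block_map_agree.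
    have km' : ((2 * k).+1 <= m)%N by lia.
    suff KG : K (block_map R1 Ga @^-1` D) = K D.
      have c1 := close _ _ lGD km; have c2 := close _ _ lD km'.
      set G := _ @^-1` D in c1 KG *.
      have -> : M G - M D = (M G - K G) - (M D - K D) by rewrite KG; ring.
      apply: (le_trans (ler_normB _ _)).
      apply: (le_trans (lerD c1 c2)); rewrite -mulrDl ler_wpM2r ?invr_ge0//.
      have le : (#|B| ^ (2 * k).+1 <= #|B| ^ (2 * (k + R1)).+1)%N.
        by rewrite leq_pexp2l//; lia.
      by rewrite -natrD ler_nat; lia.
    have perP (y : points Yh) : per_le Yh a y <->
        exists2 q, (1 <= q <= a)%N & shiftz q%:Z (dec y) = dec y.
      split=> -[q qa yq]; exists q => //.
        by rewrite -dec_shift -sigma_iter yq.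
      by apply: dec_inj; rewrite sigma_iter dec_shift.
    have hgE y : block_map R1 Th (val (g y)) = val y by rewrite -hE gh.
    have ghE y : block_map R1 Ga (val (h y)) = val y by rewrite -gE hg.
    have auG := automorphism_periodic XY stable NE (ltnW nm) rm Rm Am gE hgE.
    have auH := automorphism_periodic XY stable NE (ltnW nm) rm Rm Am hE ghE.
    pose ext (G : fullshift B -> fullshift B) (y : points Yh) : points Yh :=
      if pselect (Z (G (dec y))) is left hz then projT1 (cid (encZ _ hz)) else y.
    have extE G y : Z (G (dec y)) -> dec (ext G y) = G (dec y).
      by rewrite /ext; case: pselect => // hz _; case: cid.
    have bij : set_bij (per_le Yh a) (per_le Yh a) (ext (block_map R1 Ga)).
      split.
      - move=> y /perP[q qa yq]; apply/perP; exists q => //.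
        by have [Zy yq' _] := auG _ q qa (decZ y) yq; rewrite (extE _ _ Zy).
      - move=> y y'; rewrite !inE => /perP[q qa yq] /perP[q' qa' yq'] e.
        have [Zy _ By] := auG _ q qa (decZ y) yq.
        have [Zy' _ By'] := auG _ q' qa' (decZ y') yq'.
        apply: dec_inj; rewrite -By -By'; congr (block_map R1 Th _).
        by have := congr1 dec e; rewrite (extE _ _ Zy) (extE _ _ Zy').
      - move=> y /perP[q qa yq].
        have [Zy yq' By] := auH _ q qa (decZ y) yq.
        have yT := extE _ _ Zy.
        exists (ext (block_map R1 Th) y).
          by apply/perP; exists q => //; rewrite yT.
        have ZT : Z (block_map R1 Ga (dec (ext (block_map R1 Th) y))) by rewrite yT By.
        by apply: dec_inj; rewrite (extE _ _ ZT) yT By.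
    apply: (per_mean_bij bij) => y /perP[q qa yq].
    have [Zy _ _] := auG _ q qa (decZ y) yq.
    by rewrite !indicE; congr (nat_of_bool _)%:R; apply/idP/idP; rewrite !inE /= (extE _ _ Zy).
  pose lab (y : points Yh) := dec y 0.
  have labE (x y : points Yh) : lab x = lab y <-> val x 0 = val y 0.
    by split=> e; [rewrite !decE; congr eB|rewrite /lab /dec e].
  have le1 : hlang Y R <= hlang Yh R.
    apply: (cvgr_to_ge (@hlang_cvg _ Yh R)); exists 1%N => // l /= l1.
    apply: (le_trans (hlang_le Y R l1)); rewrite ler_wpM2r ?invr_ge0//.
    rewrite ler_ln ?posrE ?ltr0n ?lang_gt0// ler_nat.
    pose f (w : {ffun 'I_l -> B}) : {ffun 'I_l -> 'I_m} := [ffun i => eB (w i)].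
    have fi : injective f.
      move=> w w' /ffunP e; apply/ffunP => i; apply: (can_inj eBK).
      by have := e i; rewrite !ffunE.
    rewrite -(card_imset _ fi); apply/subset_leq_card/fintype.subsetP.
    move=> _ /imsetP[w /langP/(_ 0)[y yw] ->].
    have [y' y'E] := encZ _ (sub_image_cover XY n (pointsP y)).
    apply/langP => j; exists (pshift (- j) y') => i.
    rewrite ffunE -yw decE dec_shift y'E; congr (eB (val y _)); lia.
  apply: (le_trans le1); rewrite -lee_fin -top_entropy_lang -maxent.
  apply: (le_trans (measure_entropy_le muS N0 labE)).
  rewrite lee_fin ler_wpM2r ?invr_ge0// le_eqVlt; apply/orP; left; apply/eqP.
  congr entropy; apply/funext => w; congr (fine (mu Yh _)).
  apply/seteqP; split=> y /=.
    by move=> <- i; rewrite ffunE /lab sigma_iter dec_shift /shiftz add0r.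
  move=> h; apply/ffunP => i; rewrite ffunE /lab sigma_iter dec_shift /shiftz add0r.
  exact: h.
Qed.
End FiniteStage.

(** * The limit measure *)

(** The windowed sets are stable under intersection and generate the Borel sets. *)
Lemma invariant_windowed (R : realType) (B : finType) (Y : subshift B)
    (nu : probability (borel (points Y)) R) (g : points Y -> points Y) :
  continuous g ->
  (forall k C, plocal k C -> nu (g @^-1` C) = nu C) -> invariant_under nu g.
Proof.
move=> cg h E mE.
have mg : measurable_fun [set: borel (points Y)] (g : borel (points Y) -> borel (points Y)).
  by move=> _ F mF; rewrite setTI; exact: continuous_borel.
pose m2 : {measure set (borel (points Y)) -> \bar R} :=
  measure_function_pushforward__canonical__measure_function_Measure nu mg.
have m2E F : m2 F = nu (g @^-1` F) by [].
pose G := [set C : set (borel (points Y)) | exists k, plocal k C].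
have GT : G setT by exists 0%N.
rewrite -m2E.
apply: (@g_sigma_algebra_measure_unique _ R (borel (points Y)) G _ (fun=> setT)) => //.
- by move=> C [k kC]; exact: plocal_measurable kC.
- by apply/seteqP; split=> // x _; exists 0%N.
- by move=> C D GC GD; exact: (@measurableI _ (windowed Y) C D GC GD).
- by move=> C [k kC]; rewrite m2E; exact: h kC.
- by move=> _; rewrite m2E preimage_setT probability_setT ltry.
- exact: borel_windowed mE.
Qed.

Lemma bounded_ultra_cvg (R : realType) (U : set_system nat) (u : nat -> R) :
  UltraFilter U -> U [set n | 0 <= u n <= 1] ->
  exists2 l : R, 0 <= l & u @ U --> l.
Proof.
move=> UU h; have := @segment_compact R 0 1; rewrite compact_ultra.
move/(_ (u @ U) (ultra_fmap u UU)); case.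
  have h' : U (u @^-1` `[0, 1]%classic) by apply: filterS h => n /= un; rewrite in_itv.
  exact: h'.
move=> l [l01 ul]; exists l => //.
by move: l01; rewrite /= in_itv /= => /andP[].
Qed.

Section Limit.
Variables (R : realType) (S : set nat).
Variable mu : forall (a : nat) (Y : subshift 'I_a), probability (borel (points Y)) R.
Hypothesis S_pos : forall s, S s -> (0 < s)%N.
Hypothesis S_inf : infinite_set S.
Hypothesis mu_spec : forall a f r : nat, (0 < a)%N -> (0 < f)%N -> (0 < r)%N ->
  forall Y : subshift 'I_a, sofic_class f r Y ->
  [/\ per_weak_limit S (mu Y), characteristic (mu Y) & max_entropy_measure (mu Y)].
Variables (A B : finType) (X : subshift A) (Y : subshift B).
Variables (r : nat) (Phi : seq A -> B).
Hypothesis XY : block_map r Phi @` carrier X = carrier Y.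
Local Notation pi := (block_map r Phi).
Local Notation Z n := (pi @` sft_cover X n).

(** The window [-n, n] is shorter than the words of the image of X_n that are known to be
    words of Y. *)
Lemma image_cover_shadow n z :
  sft_cover X n = sft_cover X (n + omega S mu n) ->
  (2 * r <= next_time S n)%N -> Z n z ->
  exists y : points Y, agree n (val y) z.
Proof.
move=> st rm Zz; have [Sm nm] := next_timeP S_pos S_inf n.
set m := next_time S n in rm nm Sm.
have m0 : (0 < m)%N := S_pos Sm.
have lim_mu (V : subshift 'I_m) : sofic_class m m V -> per_weak_limit S (mu V).
  by move=> sV; have [] := mu_spec m0 m0 m0 sV.
have [Sa _] := approx_timeP S_inf lim_mu m m0; have := S_pos Sa => a_pos.
have mle : (m <= m ^ (2 * m).+1)%N by rewrite -[X in (X <= _)%N]expn1 leq_pexp2l.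
have ale : (m ^ (2 * m).+1 <= approx_time S mu m m m m m * m ^ (2 * m).+1)%N.
  exact: leq_pmull.
have lN : ((2 * n).+1 + 2 * r <= n + omega S mu n)%N by rewrite /omega -/m; lia.
have := image_cover_language XY (- n%:Z) st Zz lN.
move/languageE => /(_ (- n%:Z))[y Yy]; rewrite size_subword => /agree_subword yz.
by exists (mkpoint Yy).
Qed.

(** Sets of points of Y become sets of the full shift, where the functions of all stages
    are defined. With a radius that grows with the stage, no extension has to be chosen
    for each C. *)
Definition thicken n (C : set (points Y)) : set (fullshift B) :=
  [set x | exists2 y : points Y, C y & agree n (val y) x].

Lemma thicken_local n C : flocal n (thicken n C).
Proof. by move=> x x' xx' [y Cy yx]; exists y => //; exact: agree_trans yx xx'. Qed.

(** On points that are close to Y, membership in the thickening of a windowed set does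
    not depend on the radius of the thickening. *)
Lemma thickenE k n C (y : points Y) x : plocal k C -> (k <= n)%N ->
  agree n (val y) x -> thicken k C x <-> C y.
Proof.
move=> lC kn /(agree_le kn) yx; split=> [[y' Cy' y'x]|Cy]; last by exists y.
by apply: lC Cy'; apply: agree_trans y'x _; exact: agree_sym.
Qed.

Hypothesis X_stable : infinite_set
  [set n | sft_cover X n = sft_cover X (n + omega S mu n)].

Let good := [set n | sft_cover X n = sft_cover X (n + omega S mu n) /\
  (#|A| + #|B| + 2 * r <= n)%N].

(** The values of the stages on the thickening of C converge along an ultrafilter, and
    their limit m is finitely additive on windowed sets. Its extension nu inherits the
    almost invariance of the stages, whose defect is at most a constant over m(n), and
    the lower bound on the entropy of N symbols; the number of words gives the upper
    bound. *)
Theorem limit_measure : exists nu : probability (borel (points Y)) R,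
  characteristic nu /\ max_entropy_measure nu.
Proof.
have goodm n : good n -> (#|A| + #|B| + 2 * r <= next_time S n)%N.
  by move=> [_ h]; apply: (leq_trans h); apply/ltnW; exact: (next_timeP S_pos S_inf n).2.
have stages n : exists M : set (fullshift B) -> R, good n -> stage S X Y r Phi n M.
  have [gn|ngn] := pselect (good n); last by exists (fun=> 0).
  have gm := goodm _ gn.
  have Am : (#|A| <= next_time S n)%N by lia.
  have Bm : (#|B| <= next_time S n)%N by lia.
  have rm : (2 * r <= next_time S n)%N by lia.
  have [M HM] := stage_exists S_pos S_inf mu_spec XY gn.1 Am Bm rm.
  by exists M.
have {stages}[M HM] := choice stages.
have shadow n z : good n -> Z n z -> exists y : points Y, agree n (val y) z.
  move=> gn Zz; have gm := goodm _ gn.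
  by apply: image_cover_shadow gn.1 _ Zz; lia.
have M_ge0 n D : good n -> 0 <= M n D by move=> /HM[].
have M_T n : good n -> M n setT = 1 by move=> /HM[].
have M_D n k C D : good n -> flocal k C -> flocal k D -> C `&` D = set0 ->
    M n (C `|` D) = M n C + M n D by move=> /HM[_ _ + _ _]; exact.
have M_Z n C D : good n -> (forall z, Z n z -> C z <-> D z) -> M n C = M n D.
  by move=> /HM[_ _ _ + _]; exact.
have M_le1 n k D : good n -> flocal k D -> M n D <= 1.
  move=> gn lD; have lDC : flocal k (~` D).
    by move=> x y xy nDx Dy; apply: nDx; apply: lD Dy; exact: agree_sym.
  rewrite -(M_T n gn) -(setUCr D) (M_D n k)//; last exact: setICr.
  by rewrite lerDl M_ge0.
(* Along an ultrafilter all bounded sequences converge at once. *)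
have good_inf k : exists2 n, good n & (k <= n)%N.
  have [n stn] := infinite_nat_ge (maxn k (#|A| + #|B| + 2 * r)) X_stable.
  by rewrite geq_max => /andP[kn ABn]; exists n.
have FP : ProperFilter (filter_from [set: nat] (fun k => [set n | good n /\ (k <= n)%N])).
  apply: filter_from_proper; last by move=> k _; have [n ? ?] := good_inf k; exists n.
  apply: filter_from_filter; first by exists 0%N.
  move=> k l _ _; exists (maxn k l) => // n [gn]; rewrite geq_max => /andP[kn ln].
  by split.
have [U [UU FU]] := ultraFilterLemma FP.
have nearU k : U [set n | good n /\ (k <= n)%N] by apply: FU; exists k.
have UF : ProperFilter U by exact: ultra_proper.
(* The absolute value makes m nonnegative on all sets, also where the limit does
   not exist. *)
pose m C : R := `|lim (M n (thicken n C) @[n --> U])|.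
have cvgC k C : plocal k C -> M n (thicken n C) @[n --> U] --> m C.
  move=> lC; have [|l l0 Ml] := @bounded_ultra_cvg R U (fun n => M n (thicken n C)) UU.
    apply: filterS (nearU 0%N) => n [gn _] /=; rewrite M_ge0//=.
    exact: (M_le1 n n _ gn (@thicken_local n C)).
  by rewrite /m (cvg_lim _ Ml)// ger0_norm.
have near_cvg (u v : nat -> R) (l : R) : u @ U --> l ->
    (exists k, forall n, good n -> (k <= n)%N -> u n = v n) -> v @ U --> l.
  move=> ul [k uv]; apply: cvg_trans ul; apply: near_eq_cvg.
  by apply: filterS (nearU k) => n [gn kn]; exact: uv.
have cvgU (u : nat -> R) (l l' : R) : u @ U --> l -> u @ U --> l' -> l = l'.
  by move=> ul ul'; rewrite -(cvg_lim _ ul)// -(cvg_lim _ ul').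
have mT : m setT = 1.
  have lT : plocal 0 [set: points Y] by [].
  apply: (cvgU _ _ _ (cvgC _ _ lT)).
  apply: (near_cvg (fun=> 1)); first exact: cvg_cst.
  exists 0%N => n gn _; rewrite -(M_T n gn); apply: M_Z => // z Zz; split=> // _.
  by have [y yz] := shadow _ _ gn Zz; exists y.
have mU k C D : plocal k C -> plocal k D -> C `&` D = set0 -> m (C `|` D) = m C + m D.
  move=> lC lD CD; apply: (cvgU _ _ _ (cvgC _ _ (plocalU lC lD))).
  apply: (near_cvg (fun n => M n (thicken n C) + M n (thicken n D))).
    by apply: cvgD; apply: cvgC; [exact: lC|exact: lD].
  exists k => n gn kn; rewrite -(M_D n n)//; try exact: thicken_local.
    congr (M n _); apply/seteqP; split=> x.
      by move=> [[y Cy yx]|[y Dy yx]]; exists y => //; [left|right].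
    by move=> [y [Cy|Dy] yx]; [left|right]; exists y.
  apply/seteqP; split=> // x [[y Cy yx] [y' Dy' y'x]].
  suff : (C `&` D) y' by rewrite CD.
  split=> //; apply: lC Cy; apply: (agree_le kn).
  by apply: agree_trans yx _; exact: agree_sym.
have [nu nuE] := @extend_windowed B Y R m (fun=> normr_ge0 _) mT mU.
exists nu.
have nu_char : characteristic nu.
  move=> g [[h [cg ch gh hg]] gs]; apply: invariant_windowed => // k C lC.
  have hs y : h (sigma y) = sigma (h y) by rewrite -[in LHS](hg y) -gs gh.
  have [R1 HR1] := curtis_hedlund_lyndon cg gs.
  have [R2 HR2] := curtis_hedlund_lyndon ch hs.
  have [Ga gE] := HR1 (maxn R1 R2) (leq_maxl _ _).
  have [Th hE] := HR2 (maxn R1 R2) (leq_maxr _ _).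
  set Rg := maxn R1 R2 in gE hE.
  have lgC : plocal (k + Rg) (g @^-1` C).
    move=> x y xy; apply: lC; rewrite !gE; exact: block_map_agree.
  rewrite (nuE _ _ lC) (nuE _ _ lgC); congr (_%:E).
  pose G := block_map Rg Ga.
  pose q : R := (2 * #|B| ^ (2 * (k + Rg)).+1)%:R.
  have diff0 : M n (G @^-1` thicken k C) - M n (thicken k C) @[n --> U] --> (0 : R).
    apply/cvgrPdist_le => e e0; near=> n.
    have [gn nbig] : good n /\ ((4 * Rg).+1 + (2 * (k + Rg)).+1 + Num.truncn (q / e) <= n)%N.
      by near: n; exact: nearU.
    have [_ _ _ _ [Haut _]] := HM n gn.
    have nm := (next_timeP S_pos S_inf n).2.
    have Rm : ((4 * Rg).+1 <= next_time S n)%N by lia.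
    have km : ((2 * (k + Rg)).+1 <= next_time S n)%N by lia.
    have := Haut Rg Ga Th g h Rm gE hE gh hg k _ (@thicken_local k C) km.
    rewrite sub0r normrN => /le_trans; apply.
    have m0 : 0 < (next_time S n)%:R :> R by rewrite ltr0n; lia.
    rewrite ler_pdivrMr// mulrC -ler_pdivrMr//.
    apply: (@le_trans _ _ (Num.truncn (q / e)).+1%:R); last by rewrite ler_nat; lia.
    by apply/ltW; exact: truncnS_gt.
  (* On the image of X_n, thickenings of radius n and k of C coincide. *)
  have c1 : M n (thicken k C) @[n --> U] --> m C.
    apply: (near_cvg _ _ _ (cvgC _ _ lC)); exists k => n gn kn.
    apply: M_Z => // z Zz; have [y yz] := shadow _ _ gn Zz.
    by rewrite (thickenE lC kn yz) (thickenE (plocal_le kn lC) (leqnn n) yz).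
  have c2 : M n (G @^-1` thicken k C) @[n --> U] --> m (g @^-1` C).
    apply: (near_cvg _ _ _ (cvgC _ _ lgC)); exists (k + Rg)%N => n gn kn.
    apply: M_Z => // z Zz; have [y yz] := shadow _ _ gn Zz.
    rewrite (thickenE (plocal_le kn lgC) (leqnn n) yz).
    have GyGz : agree k (val (g y)) (G z).
      by rewrite gE; apply: block_map_agree; exact: agree_le yz.
    by rewrite -[_ z]/(thicken k C (G z)) (thickenE lC (leqnn k) GyGz).
  have c3 : M n (G @^-1` thicken k C) - M n (thicken k C) @[n --> U]
      --> m (g @^-1` C) - m C by exact: cvgB c2 c1.
  by apply/eqP; rewrite -subr_eq0 (cvgU _ _ _ c3 diff0).
split=> //.
have nuS : invariant_under nu (@sigma B Y).
  apply: nu_char; split=> //; exists (pshift (- 1)); split.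
  - exact: sigma_continuous.
  - move=> y V /points_nbhs[k kV]; apply/points_nbhs; exists k.+1 => y' yy'.
    by apply: kV => i ik /=; apply: yy'; lia.
  - move=> y; have -> : sigma y = pshift 1 y by exact: (sigma_iter 1).
    by rewrite pshiftD pshift0.
  - move=> y; have -> : sigma (pshift (- 1) y) = pshift 1 (pshift (- 1) y).
      exact: (sigma_iter 1).
    by rewrite pshiftD pshift0.
split=> //.
pose G0 (y : points Y) := val y 0 : B.
have G0E (x y : points Y) : G0 x = G0 y <-> val x 0 = val y 0 by [].
have mG0 : mlabel (G0 : borel (points Y) -> B) by exact: coordinate_mlabel.
pose itin (W : finType) (F : points Y -> W) N :=
  @itinerary _ (borel (points Y)) (@sigma B Y) W F N.
have mitin (W : finType) (F : points Y -> W) N :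
    mlabel (F : borel (points Y) -> W) -> mlabel (itin W F N).
  exact: (mlabel_itinerary (@sigma_measurable _ Y)).
have lower N : (0 < N)%N -> hlang Y R <= Hlaw nu (itin B G0 N) / N%:R.
  move=> N0; pose cell (w : {ffun 'I_N -> B}) :=
    [set x : fullshift B | forall i : 'I_N, x i%:Z = w i].
  have cellE w : itin B G0 N @^-1` [set w] = [set y : points Y | cell w (val y)].
    apply/seteqP; split=> y /=.
      by move=> <- i; rewrite ffunE /G0 val_sigma_iter /shiftz add0r.
    by move=> h; apply/ffunP => i; rewrite ffunE /G0 val_sigma_iter /shiftz add0r; exact: h.
  have lcell w : plocal N [set y : points Y | cell w (val y)].
    by move=> x y xy xw i; rewrite -xw; apply/esym/xy; have := ltn_ord i; lia.
  have ccell w : M n (cell w) @[n --> U] --> law nu (itin B G0 N) w.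
    rewrite /law cellE (nuE _ _ (lcell w)) /=.
    apply: (near_cvg _ _ _ (cvgC _ _ (lcell w))); exists N => n gn Nn.
    apply: M_Z => // z Zz; have [y yz] := shadow _ _ gn Zz.
    rewrite (thickenE (plocal_le Nn (lcell w)) (leqnn n) yz) /cell /=.
    have e (i : 'I_N) : val y i%:Z = z i%:Z by apply: yz; have := ltn_ord i; lia.
    by split=> yw i; rewrite -yw e.
  have := entropy_cvg UF ccell; rewrite -/(Hlaw nu (itin B G0 N)) => ce.
  rewrite ler_pdivlMr ?ltr0n//; apply: (cvgr_to_ge ce).
  apply: filterS (nearU 0%N) => n [gn _].
  have [_ _ _ _ [_ He]] := HM n gn.
  by rewrite -ler_pdivlMr ?ltr0n//; exact: He.
have upper N : Hlaw nu (itin B G0 N) <= lnlang Y R N.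
  apply: entropy_card (law_ge0 _ _) (law_sum1 _ (mitin _ _ _ mG0)) _ => w wL.
  rewrite /law (_ : _ @^-1` _ = set0) ?measure0//.
  apply/seteqP; split=> // y /= yw; move/negP: wL; apply.
  rewrite inE; apply/asboolP; exists y => i.
  by rewrite -yw ffunE /G0 val_sigma_iter /shiftz add0r.
rewrite top_entropy_lang; apply/eqP; rewrite eq_le; apply/andP; split.
  have le N : (0 < N)%N -> (measure_entropy nu (@sigma B Y) <= (lnlang Y R N / N%:R)%:E)%E.
    move=> N0; apply: (le_trans (measure_entropy_le nuS N0 G0E)).
    by rewrite lee_fin ler_wpM2r ?invr_ge0// upper.
  apply/lee_addgt0Pr => e e0.
  have [N _ hN] := cvgr_lt _ (@hlang_cvg _ Y R) (hlang Y R + e) ltac:(by rewrite ltrDl).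
  apply: (le_trans (le N.+1 isT)); rewrite -EFinD lee_fin ltW//.
  by apply: hN => /=.
pose P0 : points Y -> 'I_#|B| := fun y => enum_rank (G0 y).
have mP0 : mlabel (P0 : borel (points Y) -> _).
  by apply: coordinate_mlabel => x y e; congr enum_rank.
apply: ereal_sup_ubound; exists #|B|, P0; split=> //; congr (_%:E).
have HP N : Hlaw nu (itin _ P0 N) = Hlaw nu (itin _ G0 N).
  apply/eqP; rewrite eq_le; apply/andP; split.
    rewrite (_ : itin _ P0 N =
        (fun w : {ffun 'I_N -> B} => [ffun i => enum_rank (w i)]) \o itin _ G0 N).
      exact: (Hlaw_comp nu _ (mitin _ _ _ mG0)).
    by apply/funext => y; apply/ffunP => i; rewrite !ffunE.
  rewrite (_ : itin _ G0 N =
      (fun w : {ffun 'I_N -> 'I_#|B|} => [ffun i => enum_val (w i)]) \o itin _ P0 N).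
    exact: (Hlaw_comp nu _ (mitin _ _ _ mP0)).
  by apply/funext => y; apply/ffunP => i; rewrite !ffunE /P0 enum_rankK.
apply/esym/cvg_lim => //.
apply: (@squeeze_cvgr _ _ _ _ (fun=> hlang Y R) (fun n => lnlang Y R n / n%:R)).
- exists 1%N => // n /= n1; rewrite join_entropyE -/(itin _ P0 n) HP lower//=.
  by rewrite ler_wpM2r ?invr_ge0// upper.
- exact: cvg_cst.
- exact: hlang_cvg.
Unshelve. all: by end_near. Qed.
End Limit.

Local Close Scope ring_scope.

Theorem theorem1p2 (R : realType) (S : set nat)
  (mu : forall (a : nat) (Y : subshift 'I_a),
     probability (borel (points Y)) R)
  (S_pos : forall s, S s -> (0 < s)%N)
  (S_infinite : infinite_set S)
  (mu_spec : forall a f r : nat, (0 < a)%N -> (0 < f)%N -> (0 < r)%N ->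
     forall Y : subshift 'I_a, sofic_class f r Y ->
     [/\ per_weak_limit S (mu a Y), characteristic (mu a Y) &
         max_entropy_measure (mu a Y)])
  (A : finType) (X : subshift A)
  (X_stable : infinite_set
     [set n | sft_cover X n = sft_cover X (n + omega S mu n)])
  (B : finType) (Y : subshift B) (XY : subshift_factor X Y) :
  exists nu : probability (borel (points Y)) R,
    characteristic nu /\ max_entropy_measure nu.
Proof.
have [phi [cphi sphi phis]] := XY.
have [r /(_ r (leqnn r))[Phi phiE]] := curtis_hedlund_lyndon cphi phis.
apply: (@limit_measure R S mu S_pos S_infinite mu_spec A B X Y r Phi) => //.
apply/seteqP; split=> [_ [x Xx <-]|y Yy].
  by rewrite -(phiE (mkpoint Xx)); exact: pointsP.
have [x _ xy] := sphi (mkpoint Yy) I.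
by exists (val x); [exact: pointsP|rewrite -phiE xy].
Qed.
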